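(* Let $S$ be a locally compact Hausdorff space, let $n$ be a positive integer, and let $X=(X_1,\ldots,X_n)$ be an exchangeable random element of $S^n$ such that the law of $X_1$ is outer regular and tight; assume moreover that the $\sigma$-algebra $\mathscr{S}$ on $S$ is the Baire $\sigma$-algebra. Then the following are equivalent: (1) $X$ is $N$-extendible for all $N\ge n$; (2) $\|\mathcal T\|=1$, where $\|\mathcal T\|:=\sup\{|\mathbb{E}\, g(X_1,\ldots,X_n)| : g:S^n\to\mathbb{R}\text{ bounded measurable},\ |I(g,\pi)|\le 1 \text{ for all } \pi\in\mathscr{P}(S)\}$ and $I(g,\pi):=\int_{S^n} g(x_1,\ldots,x_n)\,\pi(dx_1)\cdots\pi(dx_n)$; (3) there is a probability measure $\nu$ on $\mathscr{P}(S)$ such that $\mathbb{P}((X_1,\ldots,X_n)\in A)=\int_{\mathscr{P}(S)}\pi^n(A)\,\nu(d\pi)$ for all $A\in\mathscr{S}^n$.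
   Context: The Baire $\sigma$-algebra of $S$ is the $\sigma$-algebra generated by the continuous functions $S\to\mathbb{R}$ with compact support. $S^n$ carries the product $\sigma$-algebra $\mathscr{S}^n$; $\mathscr{P}(S)$ is the set of probability measures on $(S,\mathscr{S})$ with the smallest $\sigma$-algebra making $\pi\mapsto\pi(B)$ measurable for all $B\in\mathscr{S}$; $\pi^n$ is the $n$-fold product measure. A random element of $S^n$ is exchangeable if its law is invariant under all permutations of coordinates; for $N\ge n$, $X$ is $N$-extendible if there is an exchangeable random element $(Y_1,\ldots,Y_N)$ of $S^N$ with $(Y_1,\ldots,Y_n)$ equal in distribution to $X$. A probability measure $P$ on $S$ is tight if for every $\epsilon>0$ there is compact $K$ with $P(K)\ge 1-\epsilon$, and outer regular if $P(A)=\inf\{P(O):O\supset A\text{ open}\}$. *)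

(* Defs.v *)
From HB Require Import structures.
From mathcomp Require Import all_boot all_order all_algebra.
From mathcomp Require Import fingroup perm.
From mathcomp Require Import all_classical all_reals all_analysis.
Set Implicit Arguments. Unset Strict Implicit. Unset Printing Implicit Defensive.
Import Order.TTheory GRing.Theory Num.Theory numFieldNormedType.Exports.
Local Open Scope classical_set_scope.
Local Open Scope ring_scope.

Definition cc_fun (R : realType) (S : topologicalType) (f : S -> R) : Prop :=
  continuous f /\ compact (closure [set x | f x != 0]).

Definition baire_gen (R : realType) (S : ptopologicalType) : set (set S) :=
  [set A : set S | exists f : S -> R, cc_fun f /\
           exists B : set R, measurable B /\ A = f @^-1` B].

Definition baire (R : realType) (S : ptopologicalType) :=
  g_sigma_algebraType (@baire_gen R S).

Definition cyl_gen d (T : measurableType d) (n : nat) : set (set ('I_n -> T)) :=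
  [set A : set ('I_n -> T) | exists (i : 'I_n) (B : set T), measurable B /\
           A = (fun x => x i) @^-1` B].

Definition prodn d (T : measurableType d) (n : nat) :=
  g_sigma_algebraType (@cyl_gen d T n).

Definition tcons (T : Type) (n : nat) (x : T) (y : 'I_n -> T) : 'I_n.+1 -> T :=
  fun i => if unlift ord0 i is Some j then y j else x.

Fixpoint iint d (T : measurableType d) (R : realType) (pi : probability T R)
    (n : nat) : (('I_n -> T) -> \bar R) -> \bar R :=
  match n with
  | 0 => fun g => g (fun _ => point)
  | m.+1 => fun g => (\int[pi]_x iint pi (fun y => g (tcons x y)))%E
  end.

Definition Ig d (T : measurableType d) (R : realType) (n : nat)
    (g : ('I_n -> T) -> R) (pi : probability T R) : \bar R :=
  iint pi (fun x => (g x)%:E).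

Definition pown d (T : measurableType d) (R : realType) (n : nat)
    (pi : probability T R) (A : set ('I_n -> T)) : \bar R :=
  iint pi (fun x => (\1_A x)%:E).

Definition exchangeable dO (Omega : measurableType dO) (R : realType)
    d (T : measurableType d) (n : nat) (P : probability Omega R)
    (Y : Omega -> prodn T n) : Prop :=
  forall (s : 'S_n) (A : set (prodn T n)), measurable A ->
    P (Y @^-1` A) = P ((fun w => (fun i => Y w (s i)) : prodn T n) @^-1` A).

Definition extendible dO (Omega : measurableType dO) (R : realType)
    d (T : measurableType d) (n : nat) (P : probability Omega R)
    (X : Omega -> prodn T n) (N : nat) (nN : (n <= N)%N) : Prop :=
  exists (dO' : measure_display) (Omega' : measurableType dO')
         (Q : probability Omega' R) (Y : Omega' -> prodn T N),
    measurable_fun setT Y /\ exchangeable Q Y /\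
    forall A : set (prodn T n), measurable A ->
      Q ((fun w => (fun i => Y w (widen_ord nN i)) : prodn T n) @^-1` A)
      = P (X @^-1` A).

Definition Tnorm dO (Omega : measurableType dO) (R : realType)
    d (T : measurableType d) (n : nat) (P : probability Omega R)
    (X : Omega -> prodn T n) : \bar R :=
  ereal_sup [set (`| \int[P]_w (g (X w))%:E |)%E | g in
    [set g : prodn T n -> R | measurable_fun setT g /\
       (exists M : R, forall x, `|g x| <= M) /\
       forall pi : probability T R, (`| Ig g pi | <= 1)%E]].

Definition tight (R : realType) (S : ptopologicalType)
    (mu : set (baire R S) -> \bar R) : Prop :=
  forall eps : R, 0 < eps -> exists K : set S,
    compact K /\ measurable (K : set (baire R S)) /\ ((1 - eps)%:E <= mu K)%E.

Definition outer_regular (R : realType) (S : ptopologicalType)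
    (mu : set (baire R S) -> \bar R) : Prop :=
  forall A : set (baire R S), measurable A ->
    mu A = ereal_inf [set mu O | O in
      [set O : set S | open O /\ measurable (O : set (baire R S)) /\ A `<=` O]].

(* Main.v *)
(** The implications are proved in a cycle, (1) -> (2) -> (3) -> (1).

    (1) -> (2): average the bound |I(g, pi)| <= 1 over the empirical measures of
    an N-extension; by exchangeability the injective index maps contribute
    E g(X), and the others form a proportion O(n^2 / N).

    (2) -> (3): (2) says that E g(X) <= sup_pi I(g, pi), so by Hahn-Banach
    I(g, .) |-> E g(X) extends to a positive normalized functional Lambda on all
    bounded functions on P(S), a finitely additive mixing measure.  Restricted
    to the vaguely continuous functions, Lambda is sigma-continuous: a failure
    would produce an ultrafilter of uniformly tight probabilities, whose limit
    functional on C_c(S) is given by a probability (Riesz) that contradicts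
    pointwise convergence to 0.  The Daniell-Stone theorem then yields nu, and
    tensors of continuous functions determine the laws on S^n.  The Riesz
    theorem is itself Daniell-Stone combined with Dini's lemma.

    (3) -> (1): the mixture of the powers pi^N is an exchangeable extension. *)
Require Import Defs.
From HB Require Import structures.
From mathcomp Require Import all_boot all_order all_algebra.
From mathcomp Require Import fingroup perm.
From mathcomp Require Import all_classical all_reals all_analysis.
From mathcomp Require Import measurable_realfun.
From mathcomp Require Import ring lra zify.
Import Order.TTheory GRing.Theory Num.Theory numFieldNormedType.Exports.
Local Open Scope classical_set_scope.
Local Open Scope ring_scope.
Set Implicit Arguments. Unset Strict Implicit. Unset Printing Implicit Defensive.

(** * Hahn-Banach *)

(** The obstacle is that [S] need be neither compact nor metrizable, so mass can escape when limits
    of probabilities on [S] are taken. Tightness of a single marginal prevents it: the functional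
    Lambda sends the integral of [f] against [pi] to the expectation of [f (X_1)], so the barycentre
    of the finitely additive mixing measure is the law of [X_1], and Markov's inequality makes most
    [pi] tight through the same compactly supported functions. The Hausdorff property and local
    compactness turn compact sets of large mass into such functions.

    Hahn-Banach is applied on all bounded functions because Lambda is prescribed on every [I(g, .)],
    and these need not be vaguely continuous; the restriction to continuous functions comes
    afterwards. Daniell-Stone fits both levels because it produces a measure directly on a
    sigma-algebra generated by functions: the Baire sets on [S], and the sets generated by the
    evaluations [pi |-> pi B] on the space of probabilities. *)

Section sublinear_functionals.
Context {R : realType} {V : lmodType R}.
Variable B : set V.
Hypothesis B_add : forall x y, B x -> B y -> B (x + y).
Hypothesis B_scale : forall c x, B x -> B (c *: x).

(** Relative to a subspace [B], so that bounded functions can be handled inside the module of all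
    functions. The inequality in the second clause amounts to positive homogeneity: apply it to
    [c^-1] as well when [0 < c], while at [c = 0] it gives [q 0 <= 0] and subadditivity gives
    [0 <= q 0]. *)
Definition sublinear_on (q : V -> R) :=
  (forall x y, B x -> B y -> q (x + y) <= q x + q y) /\
  (forall c x, 0 <= c -> B x -> q (c *: x) <= c * q x).

Lemma sublinear_opp q x : sublinear_on q -> B x -> - q (- x) <= q x.
Proof.
move=> [qD qZ] Bx; have BNx : B (- x) by rewrite -scaleN1r; exact: B_scale.
have q0 : q 0 >= 0.
  have B0 : B 0 by rewrite -(scale0r x); exact: B_scale.
  by have := qD _ _ B0 B0; rewrite addr0; lra.
by have := qD _ _ Bx BNx; rewrite subrr; lra.
Qed.

(** The pointwise infimum works. It is finite because [q x >= - q (- x) >= - p (- x)], and it is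
    subadditive because two near-minimizers, one for [x] and one for [y], can be replaced by the
    smaller of the two in the chain. *)
Lemma sublinear_chain_lb (p : V -> R) (A : set {q | sublinear_on q})
    (q0 : {q | sublinear_on q}) : A q0 ->
  (forall q, A q -> forall x, B x -> sval q x <= p x) ->
  (forall q r, A q -> A r -> (forall x, B x -> sval q x <= sval r x) \/
                             (forall x, B x -> sval r x <= sval q x)) ->
  exists q, sublinear_on q /\
    forall r, A r -> forall x, B x -> q x <= sval r x.
Proof.
move=> Aq0 Ap Atot.
pose E x := [set sval q x | q in A].
have Elb x : B x -> has_lbound (E x).
  move=> Bx; exists (- p (- x)) => _ [q Aq <-].
  have BNx : B (- x) by rewrite -scaleN1r; exact: B_scale.
  apply: le_trans (sublinear_opp (svalP q) Bx).
  by rewrite lerN2; exact: Ap.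
have E0 x : E x !=set0 by exists (sval q0 x), q0.
exists (fun x => inf (E x)); split; last first.
  by move=> r Ar x Bx; apply: ge_inf; [exact: Elb|exists r].
split=> [x y Bx By|c x c0 Bx].
  apply/ler_addgt0Pr => e e0; have e2 : 0 < e / 2 by lra.
  have [_ [q Aq <-] qx] := inf_adherent e2 (conj (E0 x) (Elb _ Bx)).
  have [_ [r Ar <-] ry] := inf_adherent e2 (conj (E0 y) (Elb _ By)).
  have [s [As sqx sry]] : exists s, [/\ A s, sval s x <= sval q x &
      sval s y <= sval r y].
    by have [h|h] := Atot _ _ Aq Ar; [exists q|exists r]; split=> //; exact: h.
  have := ge_inf (Elb _ (B_add Bx By)) (ex_intro2 _ _ s As erefl).
  move=> /= h; apply: le_trans h _.
  by have := (svalP s).1 _ _ Bx By; lra.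
have [->|cn0] := eqVneq c 0.
  rewrite mul0r scale0r; have B0 : B 0 by rewrite -(scale0r x); exact: B_scale.
  have := ge_inf (Elb _ B0) (ex_intro2 _ _ q0 Aq0 erefl).
  move=> /= h; apply: le_trans h _.
  by have := (svalP q0).2 0 0 (lexx _) B0; rewrite scale0r mul0r.
have cp : 0 < c by rewrite lt_neqAle eq_sym cn0.
rewrite mulrC -ler_pdivrMr//; apply: lb_le_inf => // _ [q Aq <-].
rewrite ler_pdivrMr// mulrC.
have := ge_inf (Elb _ (B_scale c Bx)) (ex_intro2 _ _ q Aq erefl).
by move=> /= h; apply: le_trans h _; exact: (svalP q).2.
Qed.

(* Makes a minimal sublinear [q] superadditive, hence linear. *)
Lemma sublinear_directional q y : sublinear_on q -> B y ->
  exists r, [/\ sublinear_on r, forall x, B x -> r x <= q x &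
    forall x, B x -> r x <= q (x + y) - q y].
Proof.
move=> sq By; have [qD qZ] := sq.
(* [r x] is the infimum of [E x]: [t = 0] gives [r <= q] and [t = 1] the directional inequality. The
   lower bound [- q (- x)] comes from splitting [t *: y] as [- x + (x + t *: y)]. *)
pose E x := [set q (x + t *: y) - t * q y | t in [set t : R | 0 <= t]].
have Elb x : B x -> has_lbound (E x).
  move=> Bx; exists (- q (- x)) => _ [t /= t0 <-].
  have BNx : B (- x) by rewrite -scaleN1r; exact: B_scale.
  have Bt : B (t *: y) by exact: B_scale.
  have := qD _ _ BNx (B_add Bx Bt); rewrite addKr.
  suff : t * q y <= q (t *: y) by lra.
  have [->|tn0] := eqVneq t 0.
    rewrite mul0r scale0r.
    have B0 : B 0 by rewrite -(scale0r x); exact: B_scale.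
    by have := qD _ _ B0 B0; rewrite addr0; lra.
  have tp : 0 < t by rewrite lt_neqAle eq_sym tn0.
  rewrite -ler_pdivlMl//.
  have := qZ t^-1 _ _ Bt; rewrite scalerA mulVf// scale1r; apply.
  by rewrite invr_ge0.
have E0 x : E x !=set0 by exists (q (x + 0 *: y) - 0 * q y), 0 => /=.
have infE x t : B x -> 0 <= t -> inf (E x) <= q (x + t *: y) - t * q y.
  by move=> Bx t0; apply: ge_inf; [exact: Elb|exists t].
exists (fun x => inf (E x)); split; last 2 first.
- by move=> x Bx; have := infE x 0 Bx (lexx _); rewrite scale0r mul0r addr0 subr0.
- by move=> x Bx; have := infE x 1 Bx ler01; rewrite scale1r mul1r.
split=> [x z Bx Bz|c x c0 Bx].
  apply/ler_addgt0Pr => e e0; have e2 : 0 < e / 2 by lra.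
  have [_ [t /= t0 <-] qx] := inf_adherent e2 (conj (E0 x) (Elb _ Bx)).
  have [_ [s /= s0 <-] rz] := inf_adherent e2 (conj (E0 z) (Elb _ Bz)).
  have := infE (x + z) (t + s) (B_add Bx Bz) (addr_ge0 t0 s0).
  rewrite scalerDl addrACA mulrDl.
  have := qD _ _ (B_add Bx (B_scale t By)) (B_add Bz (B_scale s By)).
  lra.
have [->|cn0] := eqVneq c 0.
  rewrite mul0r scale0r; have B0 : B 0 by rewrite -(scale0r x); exact: B_scale.
  have := infE 0 0 B0 (lexx _); rewrite scale0r mul0r addr0 subr0.
  by move=> h; apply: le_trans h _; have := qZ 0 0 (lexx _) B0;
    rewrite scale0r mul0r.
have cp : 0 < c by rewrite lt_neqAle eq_sym cn0.
rewrite mulrC -ler_pdivrMr//; apply: lb_le_inf => // _ [t /= t0 <-].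
rewrite ler_pdivrMr// mulrC.
have := infE _ _ (B_scale c Bx) (mulr_ge0 c0 t0).
have := qZ _ _ c0 (B_add Bx (B_scale t By)).
by rewrite scalerDr scalerA mulrBr mulrA; lra.
Qed.

(** Zorn's lemma with the order reversed yields a minimal sublinear functional below [p]; by
    [sublinear_directional] a minimal one is superadditive, hence linear. No functional is extended
    from a subspace: in the application the values to be prescribed are forced by [p]. *)
Lemma hahn_banach (p : V -> R) : sublinear_on p ->
  exists L : V -> R, [/\ forall x y, B x -> B y -> L (x + y) = L x + L y,
    forall c x, B x -> L (c *: x) = c * L x & forall x, B x -> L x <= p x].
Proof.
move=> sp.
pose T := {q : V -> R | sublinear_on q /\ forall x, B x -> q x <= p x}.
pose p' : T := exist _ p (conj sp (fun x _ => lexx (p x))).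
pose le (q r : T) := `[< forall x, B x -> sval r x <= sval q x >].
have [q|q r s /asboolP qr /asboolP rs|A Atot|[q [sq qp]] qmin] :=
    @ZL_preorder T p' le.
- exact/asboolP.
- by apply/asboolP => x Bx; apply: le_trans (rs _ Bx) (qr _ Bx).
- have [[q0 Aq0]|A0] := pselect (A !=set0); last first.
    by exists p' => s As; case: A0; exists s.
  pose A' := [set q : {q | sublinear_on q} | exists2 r, A r & sval r = sval q].
  have [|||q [sq qA]] := @sublinear_chain_lb p A'
      (exist _ (sval q0) (svalP q0).1).
  + by exists q0.
  + by move=> q [r Ar <-]; exact: (svalP r).2.
  + move=> q r [q' Aq' <-] [r' Ar' <-].
    by have [/asboolP h|/asboolP h] := Atot _ _ Aq' Ar'; [right|left].
  have qA' s : A s -> forall x, B x -> q x <= sval s x.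
    move=> As x Bx.
    by apply: (qA (exist _ (sval s) (svalP s).1)) => //; exists s.
  have qp x : B x -> q x <= p x.
    by move=> Bx; apply: le_trans (qA' _ Aq0 _ Bx) _; exact: (svalP q0).2.
  by exists (exist _ q (conj sq qp)) => s As; apply/asboolP => x; exact: qA'.
exists q.
have supadd x y : B x -> B y -> q x + q y <= q (x + y).
  move=> Bx By; have [r [sr rq rqy]] := sublinear_directional sq By.
  have rp z : B z -> r z <= p z.
    by move=> Bz; apply: le_trans (rq _ Bz) (qp _ Bz).
  have /asboolP/= := qmin (exist _ r (conj sr rp)) (introT (asboolP _) rq).
  by move=> /(_ _ Bx) h; have := rqy _ Bx; lra.
have qD x y : B x -> B y -> q (x + y) = q x + q y.
  move=> Bx By; apply/eqP; rewrite eq_le supadd// andbT; exact: sq.1.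
have B0 x : B x -> B 0 by move=> Bx; rewrite -(scale0r x); exact: B_scale.
have q0 : B 0 -> q 0 = 0 by move=> b0; have := qD 0 0 b0 b0; rewrite addr0; lra.
have BN x : B x -> B (- x) by move=> Bx; rewrite -scaleN1r; exact: B_scale.
have qN x : B x -> q (- x) = - q x.
  move=> Bx; have := qD _ _ Bx (BN _ Bx); rewrite subrr q0; last exact: B0 Bx.
  lra.
have qZ c x : 0 <= c -> B x -> q (c *: x) = c * q x.
  move=> c0 Bx; apply/eqP; rewrite eq_le sq.2//=.
  have := sq.2 c (- x) c0 (BN _ Bx).
  by rewrite scalerN !qN ?mulrN ?lerN2//; exact: B_scale.
split=> // c x Bx; have [c0|c0] := leP 0 c; first exact: qZ.
rewrite -[c]opprK scaleNr qN ?qZ ?oppr_ge0 ?ltW// ?mulNr//.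
exact: B_scale.
Qed.

End sublinear_functionals.

(** * Integrals of bounded functions *)

Definition fbounded {R : realType} {T : Type} (f : T -> R) :=
  exists M, forall x, `|f x| <= M.

Section fbounded.
Context {R : realType} {T : Type}.
Implicit Types f g : T -> R.

Lemma fbounded_cst (c : R) : fbounded (fun _ : T => c).
Proof. by exists `|c|. Qed.

Lemma fboundedD f g : fbounded f -> fbounded g ->
  fbounded (fun x => f x + g x).
Proof.
move=> [M fM] [N gN]; exists (M + N) => x.
by apply: le_trans (ler_normD _ _) _; exact: lerD.
Qed.

Lemma fboundedM f g : fbounded f -> fbounded g ->
  fbounded (fun x => f x * g x).
Proof.
move=> [M fM] [N gN]; exists (M * N) => x.
by rewrite normrM; apply: ler_pM.
Qed.

Lemma fbounded_indic (A : set T) : fbounded (\1_A : T -> R).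
Proof.
by exists 1 => x; rewrite indicE; case: (_ \in _); rewrite ?normr1 ?normr0.
Qed.

End fbounded.

Section bounded_integrals.
Context d (T : measurableType d) (R : realType) (P : probability T R).
Implicit Types f g : T -> R.

Lemma fbounded_integrable f : measurable_fun setT f -> fbounded f ->
  P.-integrable setT (EFin \o f).
Proof.
move=> mf [M fM]; apply: measurable_bounded_integrable => //.
  exact: fin_num_fun_lty (fin_num_measure P).
exists M; split; first exact: num_real.
by move=> x Mx t _ /=; apply: le_trans (fM t) (ltW Mx).
Qed.

Lemma EFin_Rintegral f : measurable_fun setT f -> fbounded f ->
  (\int[P]_x (f x)%:E)%E = (\int[P]_x f x)%:E.
Proof.
move=> mf bf; rewrite fineK//; apply: integrable_fin_num => //.
exact: fbounded_integrable.
Qed.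

Lemma prob_Rintegral_cst (c : R) : \int[P]_x c = c.
Proof. by rewrite Rintegral_cst//= probability_setT mulr1. Qed.

Lemma bounded_RintegralD f g : measurable_fun setT f -> fbounded f ->
  measurable_fun setT g -> fbounded g ->
  \int[P]_x (f x + g x) = \int[P]_x f x + \int[P]_x g x.
Proof.
by move=> mf bf mg bg; apply: RintegralD => //; exact: fbounded_integrable.
Qed.

Lemma bounded_RintegralZl c f : measurable_fun setT f -> fbounded f ->
  \int[P]_x (c * f x) = c * \int[P]_x f x.
Proof.
by move=> mf bf; apply: RintegralZl => //; exact: fbounded_integrable.
Qed.

Lemma bounded_le_Rintegral f g : measurable_fun setT f -> fbounded f ->
  measurable_fun setT g -> fbounded g -> (forall x, f x <= g x) ->
  \int[P]_x f x <= \int[P]_x g x.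
Proof.
by move=> mf bf mg bg fg; apply: le_Rintegral => //; exact: fbounded_integrable.
Qed.

Lemma norm_Rintegral_le f M : measurable_fun setT f ->
  (forall x, `|f x| <= M) -> `|\int[P]_x f x| <= M.
Proof.
move=> mf fM; have bf : fbounded f by exists M.
rewrite ler_norml -{1}(prob_Rintegral_cst (- M)) -{2}(prob_Rintegral_cst M).
apply/andP; split; apply: bounded_le_Rintegral => //; try exact: fbounded_cst.
- by move=> x; have := fM x; rewrite ler_norml => /andP[].
- by move=> x; have := fM x; rewrite ler_norml => /andP[].
Qed.

Lemma bounded_cvg_Rintegral (f_ : nat -> T -> R) f M :
  (forall k, measurable_fun setT (f_ k)) -> measurable_fun setT f ->
  (forall k x, `|f_ k x| <= M) ->
  (forall x, f_ ^~ x @ \oo --> f x) ->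
  (fun k => \int[P]_x f_ k x) @ \oo --> \int[P]_x f x.
Proof.
move=> mf_ mf fM f_f.
have bf : fbounded f.
  exists M => x; apply: (cvgr_to_le (cvg_norm (f_f x))).
  by apply: nearW => k; exact: fM.
have [] := @dominated_convergence _ _ _ P setT measurableT
  (fun k x => (f_ k x)%:E) (fun x => (f x)%:E) (fun=> M%:E).
- by move=> k; exact/measurable_EFinP.
- exact/measurable_EFinP.
- by apply: aeW => x _; apply: cvg_EFin; [exact: nearW|exact: f_f].
- apply: (@fbounded_integrable (fun=> M)) => //; exact: fbounded_cst.
- by apply: aeW => x k _; rewrite /= lee_fin.
by move=> _ _; rewrite EFin_Rintegral// => /fine_cvgP[].
Qed.

Lemma bounded_Rintegral_sum (f_ : nat -> T -> R) n :
  (forall i, measurable_fun setT (f_ i)) -> (forall i, fbounded (f_ i)) ->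
  \int[P]_x (\sum_(i < n) f_ i x) = \sum_(i < n) \int[P]_x f_ i x.
Proof.
move=> mf bf; elim: n => [|n IH].
  rewrite big_ord0 -[RHS]prob_Rintegral_cst; apply: eq_Rintegral => x _.
  by rewrite big_ord0.
rewrite big_ord_recr/= -IH -bounded_RintegralD//.
- by apply: eq_Rintegral => x _; rewrite big_ord_recr.
- exact: measurable_sum.
- elim: n {IH} => [|n IH]; last first.
    by under eq_fun do rewrite big_ord_recr; exact: fboundedD.
  by under eq_fun do rewrite big_ord0; exact: fbounded_cst.
Qed.

Lemma Rintegral_indic A : measurable A -> \int[P]_x \1_A x = fine (P A).
Proof. by move=> mA; rewrite /Rintegral integral_indic// setIT. Qed.

End bounded_integrals.

(** * Daniell-Stone representation *)

(** Products are included besides the lattice operations because a cover is split along a positivity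
    set by multiplying it by a [ramp]. Constants together with positive parts give Stone's
    condition. *)
Record function_algebra {R : realType} {T : Type} (L : set (T -> R)) : Prop := {
  fa_cst : forall c, L (fun=> c) ;
  fa_add : forall f g, L f -> L g -> L (fun x => f x + g x) ;
  fa_mul : forall f g, L f -> L g -> L (fun x => f x * g x) ;
  fa_pos : forall f, L f -> L (fun x => Num.max (f x) 0) ;
  fa_bounded : forall f, L f -> fbounded f }.

Record positive_functional {R : realType} {T : Type} (L : set (T -> R))
    (I : (T -> R) -> R) : Prop := {
  pf_add : forall f g, L f -> L g -> I (fun x => f x + g x) = I f + I g ;
  pf_scale : forall c f, L f -> I (fun x => c * f x) = c * I f ;
  pf_one : I (fun=> 1) = 1 ;
  pf_ge0 : forall f, L f -> (forall x, 0 <= f x) -> 0 <= I f }.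

(** For a decreasing sequence of nonnegative functions, one small term is the same as convergence to
    0; hence the existential forms. *)
Definition daniell_continuous {R : realType} {T : Type} (L : set (T -> R))
    (I : (T -> R) -> R) : Prop :=
  forall f_ : nat -> T -> R, (forall n, L (f_ n)) ->
    (forall n x, f_ n.+1 x <= f_ n x) -> (forall n x, 0 <= f_ n x) ->
    (forall x e, 0 < e -> exists n, f_ n x < e) ->
    forall e, 0 < e -> exists n, I (f_ n) <= e.

Definition positivity_sets {R : realType} {T : Type} (L : set (T -> R)) :
    set (set T) :=
  [set U | exists2 g, L g & U = [set x | 0 < g x]].

Definition ramp {R : realType} {T : Type} (g : T -> R) (n : nat) (x : T) : R :=
  Num.min 1 (n%:R * Num.max (g x) 0).

Section ramp.
Context {R : realType} {T : Type}.
Implicit Types g : T -> R.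

Lemma ramp_ge0 g n x : 0 <= ramp g n x.
Proof. by rewrite /ramp le_min ler01/= mulr_ge0// le_max lexx orbT. Qed.

Lemma ramp_le1 g n x : ramp g n x <= 1.
Proof. by rewrite /ramp ge_min lexx. Qed.

Lemma ramp_mono g n x : ramp g n x <= ramp g n.+1 x.
Proof.
have h : n%:R * Num.max (g x) 0 <= n.+1%:R * Num.max (g x) 0.
  by rewrite ler_wpM2r ?ler_nat// le_max lexx orbT.
by rewrite /ramp le_min !ge_min lexx/= h orbT.
Qed.

Lemma ramp_eq0 g n x : ~ 0 < g x -> ramp g n x = 0.
Proof.
move=> /negP; rewrite -leNgt => g0.
by rewrite /ramp (max_idPr g0) mulr0 (min_idPr _)// ler01.
Qed.

Lemma ramp_eq1 g x : 0 < g x ->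
  exists m, forall n, (m <= n)%N -> ramp g n x = 1.
Proof.
move=> g0; exists (Num.truncn (g x)^-1).+1 => n mn.
apply/min_idPl; rewrite (max_idPl (ltW g0)) -ler_pdivrMr// div1r.
by apply: le_trans (ltW (truncnS_gt _)) _; rewrite ler_nat.
Qed.

Lemma cvg_ramp g x : ramp g ^~ x @ \oo --> (\1_[set y | 0 < g y] x : R).
Proof.
have [g0|g0] := pselect (0 < g x); last first.
  rewrite indicE memNset//; apply: cvg_near_cst.
  by apply: nearW => n; exact: ramp_eq0.
rewrite indicE mem_set//; apply: cvg_near_cst.
by have [m rm] := ramp_eq1 g0; exists m => // n /= /rm.
Qed.

End ramp.

Section function_algebra_lemmas.
Context {R : realType} {T : Type} (L : set (T -> R)).
Hypothesis LA : function_algebra L.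
Implicit Types f g : T -> R.

Lemma fa_scale c f : L f -> L (fun x => c * f x).
Proof. by move=> Lf; apply: fa_mul => //; exact: fa_cst. Qed.

Lemma fa_sub f g : L f -> L g -> L (fun x => f x - g x).
Proof.
move=> Lf Lg; under eq_fun do rewrite -mulN1r.
by apply: fa_add => //; exact: fa_scale.
Qed.

Lemma fa_min f g : L f -> L g -> L (fun x => Num.min (f x) (g x)).
Proof.
move=> Lf Lg.
rewrite (_ : (fun _ => _) = fun x => f x - Num.max (f x - g x) 0); last first.
  apply/funext => x; rewrite /Num.min /Num.max.
  by case: ifPn; case: ifPn; rewrite ?subr_lt0; lra.
by apply: fa_sub => //; apply: fa_pos => //; exact: fa_sub.
Qed.

Lemma fa_sum (f_ : nat -> T -> R) n : (forall i, L (f_ i)) ->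
  L (fun x => \sum_(i < n) f_ i x).
Proof.
move=> Lf; elim: n => [|n IH].
  by under eq_fun do rewrite big_ord0; exact: fa_cst.
by under eq_fun do rewrite big_ord_recr; exact: fa_add.
Qed.

Lemma fa_ramp g n : L g -> L (ramp g n).
Proof.
by move=> Lg; apply: fa_min; [exact: fa_cst|apply: fa_scale; exact: fa_pos].
Qed.

Lemma positivity_setsT : positivity_sets L setT.
Proof.
exists (fun=> 1); first exact: fa_cst.
by apply/seteqP; split => // x _ /=; exact: ltr01.
Qed.

Lemma positivity_setsI : setI_closed (positivity_sets L).
Proof.
move=> _ _ [f Lf ->] [g Lg ->]; exists (fun x => Num.min (f x) (g x)).
  exact: fa_min.
by apply/seteqP; split => x /=; rewrite lt_min => /andP.
Qed.

Variable I : (T -> R) -> R.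
Hypothesis PI : positive_functional L I.

Lemma pf_cst c : I (fun=> c) = c.
Proof.
rewrite (_ : (fun=> c) = fun x : T => c * 1); last by apply/funext => x; rewrite mulr1.
by rewrite (pf_scale PI)// ?(pf_one PI) ?mulr1//; exact: fa_cst.
Qed.

Lemma pf_sub f g : L f -> L g -> I (fun x => f x - g x) = I f - I g.
Proof.
move=> Lf Lg; under eq_fun do rewrite -mulN1r.
by rewrite (pf_add PI)// ?(pf_scale PI)// ?mulN1r//; exact: fa_scale.
Qed.

Lemma pf_le f g : L f -> L g -> (forall x, f x <= g x) -> I f <= I g.
Proof.
move=> Lf Lg fg; rewrite -subr_ge0 -pf_sub//.
by apply: (pf_ge0 PI); [exact: fa_sub|move=> x; rewrite subr_ge0].
Qed.

Lemma pf_sum (f_ : nat -> T -> R) n : (forall i, L (f_ i)) ->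
  I (fun x => \sum_(i < n) f_ i x) = \sum_(i < n) I (f_ i).
Proof.
move=> Lf; elim: n => [|n IH].
  by under eq_fun do rewrite big_ord0; rewrite big_ord0 pf_cst.
under eq_fun do rewrite big_ord_recr; rewrite big_ord_recr/= -IH.
by rewrite (pf_add PI)//; exact: fa_sum.
Qed.

End function_algebra_lemmas.

Section daniell_stone.
Context {R : realType} d {T : measurableType d}.
Variables (L : set (T -> R)) (I : (T -> R) -> R).
Hypothesis LA : function_algebra L.
Hypothesis PI : positive_functional L I.
Hypothesis CI : daniell_continuous L I.

(** An increasing sequence whose supremum is at least 1 on [A] stands for a lower semicontinuous
    majorant of the indicator, and [c] bounds its integral. Keeping the sequence avoids extending
    [I] to monotone limits. *)
Definition upper_cover (A : set T) (c : R) := exists f_ : nat -> T -> R,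
  [/\ forall n, L (f_ n), forall n x, 0 <= f_ n x,
      forall n x, f_ n x <= f_ n.+1 x, forall n, I (f_ n) <= c &
      forall x, A x -> forall e, 0 < e -> exists n, 1 - e <= f_ n x].

Let ou (A : set T) : R := inf [set c | upper_cover A c].

Lemma upper_cover_ge0 A c : upper_cover A c -> 0 <= c.
Proof.
by move=> [f_ [Lf f0 _ /(_ 0%N) fc _]]; apply: le_trans fc; apply: (pf_ge0 PI).
Qed.

Lemma upper_cover_fun A f : L f -> (forall x, 0 <= f x) ->
  (forall x, A x -> 1 <= f x) -> upper_cover A (I f).
Proof.
move=> Lf f0 fA; exists (fun=> f); split=> // x Ax e e0; exists 0%N.
by have := fA _ Ax; lra.
Qed.

Let ou_has A : has_inf [set c | upper_cover A c].
Proof.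
split; first by exists (I (fun=> 1)); apply: upper_cover_fun => //; exact: fa_cst.
by exists 0 => c; exact: upper_cover_ge0.
Qed.

Let ou_le A c : upper_cover A c -> ou A <= c.
Proof. by move=> Ac; apply: ge_inf => //; exact: (ou_has A).2. Qed.

Let ou_adh A e : 0 < e -> exists2 c, upper_cover A c & c < ou A + e.
Proof. by move=> e0; exact: inf_adherent e0 (ou_has A). Qed.

Let ou_ge0 A : 0 <= ou A.
Proof. by apply: lb_le_inf (ou_has A).1 _ => c; exact: upper_cover_ge0. Qed.

Let ou0 : ou set0 = 0.
Proof.
apply/eqP; rewrite eq_le ou_ge0 andbT.
have <- : I (fun=> 0) = 0 by exact: pf_cst LA _ PI _.
by apply/ou_le/upper_cover_fun => //; exact: fa_cst.
Qed.

Let ou_mono (A B : set T) : A `<=` B -> ou A <= ou B.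
Proof.
move=> AB; apply: lb_le_inf (ou_has B).1 _ => c [f_ [Lf f0 fi fc fB]].
by apply: ou_le; exists f_; split=> // x /AB; exact: fB.
Qed.

Let ou_mono_chain (f_ : nat -> T -> R) : (forall n x, f_ n x <= f_ n.+1 x) ->
  forall m n x, (m <= n)%N -> f_ m x <= f_ n x.
Proof.
move=> fi m n x mn; apply: (@homo_leq _ (f_ ^~ x) (fun a b => a <= b)) => //.
by move=> y z t; exact: le_trans.
Qed.

Let dmu (A : set T) : \bar R := (ou A)%:E.

Let dmu_sigma_subadditive : sigma_subadditive dmu.
Proof.
move=> F; set S := (X in (_ <= X)%E).
have dmu_ge0 n : (0 <= dmu (F n))%E by rewrite lee_fin ou_ge0.
have [->|Soo] := eqVneq S +oo%E; first exact: leey.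
have S0 : (0 <= S)%E by apply: nneseries_ge0.
have [s Ss] : exists s, S = s%:E.
  by exists (fine S); rewrite fineK// ge0_fin_numE// ltey.
have ps N : \sum_(n < N) ou (F n) <= s.
  rewrite -lee_fin -Ss -sumEFin -(big_mkord xpredT (fun n => (ou (F n))%:E)).
  by apply: nneseries_lim_ge => n _ _; exact: dmu_ge0.
rewrite Ss lee_fin; apply/ler_addgt0Pr => e e0.
(* The usual geometric allowance: the errors of the individual covers add up to at most [e]. *)
pose w n : R := e * 2^-1 ^+ n.+1.
have w0 n : 0 < w n by rewrite mulr_gt0// exprn_gt0//; lra.
have wsum N : \sum_(n < N) w n <= e.
  suff -> : \sum_(n < N) w n = e - e * 2^-1 ^+ N.
    by rewrite gerBl mulr_ge0 ?exprn_ge0//; lra.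
  elim: N => [|N IH]; first by rewrite big_ord0 expr0; lra.
  by rewrite big_ord_recr/= IH /w exprS; lra.
have /choice[f fP] n : exists f_ : nat -> T -> R,
    [/\ forall n, L (f_ n), forall n x, 0 <= f_ n x,
    forall n x, f_ n x <= f_ n.+1 x, forall k, I (f_ k) <= ou (F n) + w n &
    forall x, F n x -> forall e, 0 < e -> exists n, 1 - e <= f_ n x].
  have [c [f_ [? ? ? fc ?]] cw] := ou_adh (F n) (w0 n).
  by exists f_; split=> // k; apply: le_trans (fc k) (ltW cw).
(* A diagonal sum: stage [N] adds the [N]-th terms of the first [N] covers, so a single increasing
   sequence covers the union. *)
apply: ou_le; exists (fun N x => \sum_(n < N) f n N x); split.
- by move=> N; apply: (fa_sum LA (f_ := fun n => f n N)) => n; have [] := fP n.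
- by move=> N x; apply: sumr_ge0 => n _; have [] := fP n.
- move=> N x; rewrite big_ord_recr/=; apply: ler_wpDr; first by have [] := fP N.
  by apply: ler_sum => n _; have [] := fP n.
- move=> N; rewrite (pf_sum LA PI (f_ := fun n => f n N)); last first.
    by move=> n; have [] := fP n.
  apply: (@le_trans _ _ (\sum_(n < N) (ou (F n) + w n))).
    by apply: ler_sum => n _; have [] := fP n.
  by rewrite big_split; exact: lerD (ps N) (wsum N).
- move=> x [n _ Fnx] e' e'0; have [Lf f0 fi _ fF] := fP n.
  have [m fm] := fF _ Fnx _ e'0; exists (maxn m n.+1).
  have nm : (n < maxn m n.+1)%N by rewrite leq_max ltnSn orbT.
  rewrite (bigD1 (Ordinal nm))//=; apply: ler_wpDr.
    by apply: sumr_ge0 => i _; have [] := fP i.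
  apply: le_trans fm _; apply: ou_mono_chain => //; exact: leq_maxl.
Qed.

HB.instance Definition _ := isOuterMeasure.Build R T dmu
  (congr1 EFin ou0) (fun A => ou_ge0 A : (0%:E <= dmu A)%E)
  (fun A B AB => ou_mono AB : (dmu A <= dmu B)%E) dmu_sigma_subadditive.

(** A near-optimal cover [f_] of [A] is split by ramps: [f_ n * ramp g n] covers the part inside
    [U], and [f_ n * (1 - ramp g m)] the part outside, where the ramp vanishes. With [m] such that
    [I (h m)] is within [e / 2] of its supremum, the two costs add up to at most [c + e / 2]. *)
Lemma positivity_caratheodory g : L g -> dmu.-caratheodory [set x | 0 < g x].
Proof.
move=> Lg; set U := [set x | 0 < g x]; apply: le_caratheodory_measurable => A.
rewrite -EFinD lee_fin; apply/ler_addgt0Pr => e e0.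
have e2 : 0 < e / 2 by lra.
have [c [f_ [Lf f0 fi fc fA]] cA] := ou_adh A e2.
pose h n x := f_ n x * ramp g n x.
have Lh n : L (h n) by apply: fa_mul => //; exact: fa_ramp.
have st0 n x : 0 <= ramp g n x by exact: ramp_ge0.
have st1 n x : ramp g n x <= 1 by exact: ramp_le1.
have hi n x : h n x <= h n.+1 x by apply: ler_pM => //; exact: ramp_mono.
pose E := [set I (h n) | n in [set: nat]].
have E0 : E !=set0 by exists (I (h 0%N)), 0%N.
have Eub : has_ubound E.
  exists c => _ [n _ <-]; apply: le_trans (fc n); apply: (pf_le LA PI) => // x.
  by rewrite ler_piMr.
have AU : ou (A `&` U) <= sup E.
  apply: ou_le; exists h; split=> //.
  - by move=> n x; rewrite mulr_ge0.
  - by move=> n; apply: ub_le_sup => //; exists n.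
  - move=> x [Ax Ux] e' e'0; have [m fm] := fA _ Ax _ e'0.
    have [m' sm] := ramp_eq1 Ux; exists (maxn m m').
    rewrite /h sm ?leq_maxr// mulr1; apply: le_trans fm _.
    by apply: ou_mono_chain => //; exact: leq_maxl.
have [_ [m _ <-] mE] := sup_adherent e2 (conj E0 Eub).
have ANU : ou (A `&` ~` U) <= c - sup E + e / 2.
  apply: ou_le; exists (fun n x => f_ n x * (1 - ramp g m x)); split.
  - move=> n; apply: fa_mul => //; apply: fa_sub => //; first exact: fa_cst.
    exact: fa_ramp.
  - by move=> n x; rewrite mulr_ge0// subr_ge0.
  - by move=> n x; rewrite ler_wpM2r// subr_ge0.
  (* Raising the index to [maxn n m] only enlarges the function, and makes
     [f_ (maxn n m) * ramp g m] dominate [h m]. *)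
  - move=> n; apply: (@le_trans _ _ (I (fun x =>
        f_ (maxn n m) x - f_ (maxn n m) x * ramp g m x))).
      apply: (pf_le LA PI).
      + apply: fa_mul => //; apply: fa_sub => //; first exact: fa_cst.
        exact: fa_ramp.
      + by apply: fa_sub => //; apply: fa_mul => //; exact: fa_ramp.
      + move=> x; rewrite -[leRHS](_ : f_ (maxn n m) x * (1 - ramp g m x) = _).
          2: by rewrite mulrBr mulr1.
        rewrite ler_wpM2r ?subr_ge0//.
        by apply: ou_mono_chain => //; exact: leq_maxl.
    rewrite (pf_sub LA PI)//; last by apply: fa_mul => //; exact: fa_ramp.
    have : I (h m) <= I (fun x => f_ (maxn n m) x * ramp g m x).
      apply: (pf_le LA PI) => //; first by apply: fa_mul => //; exact: fa_ramp.
      move=> x; rewrite ler_wpM2r//; apply: ou_mono_chain => //.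
      exact: leq_maxr.
    by have := fc (maxn n m); lra.
  - move=> x [Ax Ux] e' e'0; have [k fk] := fA _ Ax _ e'0.
    by exists k; rewrite ramp_eq0// subr0 mulr1.
by lra.
Qed.

(** The one place where Daniell continuity acts: for a cover of the whole space, the positive parts
    of [1 - f_ n] decrease to 0, so [I (f_ n)] must come arbitrarily close to 1. *)
Let ouT : ou setT = 1.
Proof.
apply/eqP; rewrite eq_le; apply/andP; split.
  by rewrite -(pf_one PI); apply/ou_le/upper_cover_fun => //; exact: fa_cst.
apply: lb_le_inf (ou_has setT).1 _ => c [f_ [Lf f0 fi fc fT]].
apply/ler_addgt0Pr => e e0.
have [|||| n In] := CI (f_ := fun n x => Num.max (1 - f_ n x) 0) _ _ _ _ e0.
- by move=> n; apply: fa_pos => //; apply: fa_sub => //; exact: fa_cst.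
- move=> n x; rewrite ge_max !le_max lexx orbT andbT.
  by rewrite lerB.
- by move=> n x; rewrite le_max lexx orbT.
- move=> x e' e'0; have e2 : 0 < e' / 2 by lra.
  have [n fn] := fT x Logic.I _ e2; exists n.
  by rewrite gt_max e'0 andbT; lra.
have : I (fun x => 1 - f_ n x) <= I (fun x => Num.max (1 - f_ n x) 0).
  have L1 : L (fun x => 1 - f_ n x) by apply: fa_sub => //; exact: fa_cst.
  by apply: (pf_le LA PI) => //; [exact: fa_pos|move=> x; rewrite le_max lexx].
rewrite (pf_sub LA PI)//; last exact: fa_cst.
by rewrite (pf_one PI); have := fc n; lra.
Qed.

(** An inclusion only, so membership in [L] does not by itself give measurability; this is why
    measurability is a separate assumption in the representation formula. *)
Hypothesis mL : measurable `<=` <<s positivity_sets L >>.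

Let measurable_caratheodory (A : set T) :
  measurable A -> dmu.-caratheodory A.
Proof.
move=> /mL; apply: smallest_sub => [|U [g Lg ->]].
  exact: (sigma_algebra_measurable (caratheodory_type dmu)).
exact: positivity_caratheodory.
Qed.

Definition daniell_measure (A : set T) : \bar R := dmu A.

Let daniell_sigma_additive : semi_sigma_additive daniell_measure.
Proof.
move=> F mF tF mUF.
apply: (@caratheodory_measure_sigma_additive _ _ dmu F) => //.
- by move=> i; exact: measurable_caratheodory.
- exact: measurable_caratheodory.
Qed.

HB.instance Definition _ := isMeasure.Build _ _ _ daniell_measure
  (congr1 EFin ou0) (fun A => ou_ge0 A : (0%:E <= dmu A)%E)
  daniell_sigma_additive.

HB.instance Definition _ := Measure_isProbability.Build _ _ _ daniell_measure
  (congr1 EFin ouT).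

(** Layer-cake argument: [K * f] is cut into slices [t i] between the levels [i] and [i + 1], with
    [t i] below the indicator of [A i] and equal to 1 on [A i.+1]. The shift by one level costs at
    most [ou (A 0) <= 1], that is [1 / K] after division, whence the choice of [K]. *)
Lemma unit_Rintegral_le f : L f -> measurable_fun setT f ->
  (forall x, 0 <= f x <= 1) -> \int[daniell_measure]_x f x <= I f.
Proof.
move=> Lf mf f01; apply/ler_addgt0Pr => e e0.
have [k ke] : exists k : nat, k.+1%:R^-1 <= e.
  exists (Num.truncn e^-1); rewrite invf_ple ?posrE//.
  exact/ltW/truncnS_gt.
set K : R := k.+1%:R.
have K0 : 0 < K by rewrite ltr0n.
pose t i x := Num.min (K * f x) i.+1%:R - Num.min (K * f x) i%:R.
pose A i := [set x | i%:R < K * f x].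
have Lt i : L (t i).
  by apply: fa_sub => //; apply: fa_min => //; [exact: fa_scale|exact: fa_cst|
    exact: fa_scale|exact: fa_cst].
have t01 i x : 0 <= t i x <= 1.
  have : i%:R + 1 = i.+1%:R :> R by rewrite -natr1.
  by rewrite /t /Num.min; case: ifPn; case: ifPn; rewrite -?leNgt; lra.
have mA i : measurable (A i).
  have -> : A i = (fun x => K * f x) @^-1` `]i%:R, +oo[%classic.
    by apply/seteqP; split => x /=; rewrite in_itv/= andbT.
  rewrite -[X in measurable X]setTI.
  suff : measurable_fun setT (fun x => K * f x) by apply.
  exact: measurable_funM.
have sumt n x : \sum_(i < n) t i x = Num.min (K * f x) n%:R.
  elim: n => [|n IH].
    have /andP[f0 _] := f01 x.
    by rewrite big_ord0 (min_idPr _)//; exact: mulr_ge0 (ltW K0) f0.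
  by rewrite big_ord_recr/= IH /t; lra.
have sumtK x : \sum_(i < k.+1) t i x = K * f x.
  have /andP[_ f1] := f01 x.
  by rewrite sumt; apply/min_idPl; exact: ler_piMr (ltW K0) f1.
have tA i x : t i x <= \1_(A i) x.
  rewrite indicE; case: (boolP (x \in A i)); first by case/andP: (t01 i x).
  rewrite notin_setE /A/= => /negP; rewrite -leNgt => Kf.
  have Kf' : K * f x <= i.+1%:R by apply: le_trans Kf _; rewrite ler_nat.
  by rewrite /t !(min_idPl _)// subrr.
have ouA i : ou (A i.+1) <= I (t i).
  apply: ou_le; apply: upper_cover_fun => // x; first by case/andP: (t01 i x).
  rewrite /A/= => Kf; have Kf' : i%:R <= K * f x.
    by apply: le_trans (ltW Kf); rewrite ler_nat.
  by rewrite /t (min_idPr (ltW Kf)) (min_idPr Kf') -natr1; lra.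
have ouA0 : ou (A 0%N) <= 1 by rewrite -ouT; exact: ou_mono.
have bf : fbounded f by exact: fa_bounded LA _ Lf.
have bound1 : K * \int[daniell_measure]_x f x <= \sum_(i < k.+1) ou (A i).
  have mA1 i : measurable_fun setT (\1_(A i) : T -> R) by exact: measurable_indic.
  have bA1 i : fbounded (\1_(A i) : T -> R).
    exact: fbounded_indic.
  rewrite -bounded_RintegralZl//.
  apply: (@le_trans _ _ (\int[daniell_measure]_x (\sum_(i < k.+1) \1_(A i) x))).
    apply: bounded_le_Rintegral.
    + exact: measurable_funM.
    + by apply: fboundedM => //; exact: fbounded_cst.
    + exact: measurable_sum.
    + exists k.+1%:R => x; apply: le_trans (ler_norm_sum _ _ _) _.
      rewrite -[X in _ <= X%:R](card_ord k.+1) -sum1_card natr_sum.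
      by apply: ler_sum => i _; rewrite indicE; case: (_ \in _); rewrite ?normr1 ?normr0.
    + by move=> x; rewrite -sumtK; apply: ler_sum => i _; exact: tA.
  rewrite (bounded_Rintegral_sum _ (f_ := fun i => \1_(A i)))//.
  by apply: ler_sum => i _; rewrite Rintegral_indic.
have bound2 : \sum_(i < k.+1) ou (A i) <= 1 + K * I f.
  rewrite big_ord_recl/=; apply: lerD => //.
  apply: (@le_trans _ _ (\sum_(i < k) I (t i))).
    by apply: ler_sum => i _; rewrite ouA.
  have -> : K * I f = \sum_(i < k.+1) I (t i).
    rewrite -(pf_sum LA PI)// -(pf_scale PI)//.
    by congr I; apply/funext => x; rewrite sumtK.
  rewrite [leRHS]big_ord_recr/= lerDl; apply: (pf_ge0 PI) => // x.
  by case/andP: (t01 k x).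
have : K * \int[daniell_measure]_x f x <= K * (K^-1 + I f).
  by rewrite mulrDr mulfV ?gt_eqF//; exact: le_trans bound1 bound2.
rewrite ler_pM2l// addrC => /le_trans; apply; exact: lerD.
Qed.

Lemma daniell_measureE f : L f -> measurable_fun setT f ->
  \int[daniell_measure]_x f x = I f.
Proof.
move=> Lf mf; have bf := fa_bounded LA Lf; have [M fM] := bf.
pose m := `|M| + 1; have m0 : 0 < m by rewrite ltr_pwDr.
have fm x : - m <= f x <= m.
  by rewrite -ler_norml (le_trans (fM x))// /m (le_trans (ler_norm M))// lerDl.
(* The map [(g + m) / (2 * m)] brings [g] into the unit interval; the inequality for [f] and for
   [- f] then gives equality. *)
have le_unit g : L g -> measurable_fun setT g -> (forall x, - m <= g x <= m) ->
    \int[daniell_measure]_x g x <= I g.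
  move=> Lg mg gm; have bg := fa_bounded LA Lg.
  have := @unit_Rintegral_le (fun x => (2 * m)^-1 * (g x + m)) _ _ _.
  rewrite bounded_RintegralZl//; last 2 first.
  - by apply: measurable_funD => //; exact: measurable_cst.
  - by apply: fboundedD => //; exact: fbounded_cst.
  have Lgm : L (fun x => g x + m) by apply: fa_add => //; exact: fa_cst.
  rewrite bounded_RintegralD//; last exact: fbounded_cst.
  rewrite prob_Rintegral_cst (pf_scale PI)// (pf_add PI)//; last exact: fa_cst.
  rewrite (pf_cst LA PI) ler_pM2l ?invr_gt0//; last by lra.
  rewrite lerD2r; apply.
  - exact: fa_scale.
  - by apply: measurable_funM => //; apply: measurable_funD.
  - move=> x; have /andP[h1 h2] := gm x; apply/andP; split.
      by rewrite mulr_ge0 ?invr_ge0; lra.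
    by rewrite ler_pdivrMl; lra.
apply/eqP; rewrite eq_le le_unit//=.
have := le_unit (fun x => -1 * f x) (fa_scale LA _ Lf) _ _.
rewrite bounded_RintegralZl// (pf_scale PI)// !mulN1r lerN2; apply.
- exact: measurable_funM.
- by move=> x; have := fm x; lra.
Qed.

Theorem daniell_stone : exists mu : probability T R,
  forall f, L f -> measurable_fun setT f -> \int[mu]_x f x = I f.
Proof. by exists (daniell_measure : probability T R) => f; exact: daniell_measureE. Qed.

End daniell_stone.

(** * Powers of a probability *)

Lemma measurable_prob_pi_system {R : realType} dU (U : measurableType dU)
    dV (V : measurableType dV) (k : U -> probability V R) (G : set (set V)) :
  measurable = <<s G >> -> setI_closed G ->
  (forall A, G A -> measurable_fun setT (fun u => k u A)) ->
  forall A, measurable A -> measurable_fun setT (fun u => k u A).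
Proof.
move=> mG GI kG.
pose H := [set A : set V | measurable A /\ measurable_fun setT (fun u => k u A)].
have HP : lambda_system setT H.
  split=> //.
  - split=> //; rewrite (_ : (fun _ => _) = cst 1%E)//.
    by apply/funext => u; rewrite probability_setT.
  - move=> A B BA [mA kA] [mB kB]; split; first exact: measurableD.
    rewrite (_ : (fun _ => _) = (fun u => k u A - k u B)%E); last first.
      apply/funext => u; rewrite measureD// ?(setIidr BA)//.
      by rewrite ltey_eq fin_num_measure.
    exact: emeasurable_funB.
  - move=> F ndF HF; have mF i : measurable (F i) by have [] := HF i.
    split; first exact: bigcup_measurable.
    apply: (@emeasurable_fun_cvg _ _ _ _ (fun i u => k u (F i))).
      by move=> i; have [] := HF i.
    by move=> u _; apply: nondecreasing_cvg_mu => //; exact: bigcup_measurable.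
have sH : <<s G >> `<=` H.
  apply: (lambda_system_subset GI HP) => // A GA.
  by split; [rewrite mG; exact: sub_sigma_algebra|exact: kG].
by move=> A; rewrite {1}mG => /sH[].
Qed.

Section image_probability.
Context {R : realType} dU (U : measurableType dU) dV (V : measurableType dV).
Variables (P : probability U R) (f : U -> V).
Hypothesis mf : measurable_fun setT f.

Definition image_prob : probability V R :=
  distribution P (MeasurableFun.Pack (MeasurableFun.Class
    (isMeasurableFun.Build _ _ _ _ f mf))).

Lemma image_probE A : image_prob A = P (f @^-1` A).
Proof. by []. Qed.

Lemma integral_image_prob (g : V -> R) : measurable_fun setT g -> fbounded g ->
  (\int[image_prob]_y (g y)%:E = \int[P]_x (g (f x))%:E)%E.
Proof.
move=> mg [M gM]; apply: integral_distribution; first exact/measurable_EFinP.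
apply: (@fbounded_integrable _ _ _ _ (g \o f)); last by exists M => x; exact: gM.
exact: measurableT_comp.
Qed.

Lemma Rintegral_image_prob (g : V -> R) : measurable_fun setT g -> fbounded g ->
  \int[image_prob]_y g y = \int[P]_x g (f x).
Proof. by move=> mg bg; congr fine; exact: integral_image_prob. Qed.

End image_probability.

Section product_probability.
Context {R : realType} d1 (T1 : measurableType d1) d2 (T2 : measurableType d2).
Variables (P1 : probability T1 R) (P2 : probability T2 R).
Local Open Scope ereal_scope.

Definition prod_prob : set (T1 * T2) -> \bar R := (P1 \x P2).

HB.instance Definition _ := Measure.on prod_prob.

Let prod_probT : prod_prob setT = 1.
Proof.
rewrite /prod_prob -setXTT product_measure1E//.
by rewrite [X in X * _]probability_setT [X in _ * X]probability_setT mule1.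
Qed.

HB.instance Definition _ := Measure_isProbability.Build _ _ _
  prod_prob prod_probT.

Lemma integral_prod_prob (g : T1 * T2 -> R) :
  measurable_fun setT g -> fbounded g ->
  \int[prod_prob]_z (g z)%:E = \int[P1]_x \int[P2]_y (g (x, y))%:E.
Proof.
move=> mg bg; rewrite -[LHS]integral12_prod_meas1//.
exact: fbounded_integrable (prod_prob : probability _ R) _ mg bg.
Qed.

End product_probability.

Lemma tcons0 (T : Type) n (x : T) (y : 'I_n -> T) : tcons x y ord0 = x.
Proof. by rewrite /tcons unlift_none. Qed.

Lemma tconsS (T : Type) n (x : T) (y : 'I_n -> T) i : tcons x y (lift ord0 i) = y i.
Proof. by rewrite /tcons liftK. Qed.

(** * Finite powers: iterated integrals, rectangles and uniqueness *)

Section prodn.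
Context d (T : measurableType d) {R : realType}.
Implicit Types (n : nat) (pi : probability T R).

Lemma measurable_coord n (i : 'I_n) :
  measurable_fun setT (fun x : prodn T n => x i).
Proof.
move=> _ B mB; rewrite setTI; apply: sub_sigma_algebra.
by exists i, B.
Qed.

Lemma measurable_fun_prodn dU (U : measurableType dU) n (f : U -> prodn T n) :
  (forall i, measurable_fun setT (fun u => f u i)) -> measurable_fun setT f.
Proof.
move=> mf; apply: (measurability (@cyl_gen _ T n : set (set (prodn T n)))) => //.
by move=> _ [_ [i [B [mB ->]]] <-]; exact: (mf i _ _ mB).
Qed.

Lemma measurable_tcons n : measurable_fun setT
  (fun z : T * prodn T n => tcons z.1 z.2 : prodn T n.+1).
Proof.
apply: measurable_fun_prodn => i; have [j ->|->] := unliftP ord0 i.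
  apply: (eq_measurable_fun (fun z : T * prodn T n => z.2 j)).
    by move=> z _; rewrite tconsS.
  exact: measurableT_comp (measurable_coord j) measurable_snd.
apply: (eq_measurable_fun (fun z : T * prodn T n => z.1)); last exact: measurable_fst.
by move=> z _; rewrite tcons0.
Qed.

(** Replaces the iterated integral by the integral against one measure, so that linearity,
    monotonicity and dominated convergence become available on [prodn T n]. *)
Lemma iint_prob pi n : exists Q : probability (prodn T n) R,
  forall g : prodn T n -> R, measurable_fun setT g -> fbounded g ->
  iint pi (fun x => (g x)%:E) = (\int[Q]_x (g x)%:E)%E.
Proof.
elim: n => [|n [Q IH]].
  (* [prodn T 0] has a single element, the one at which [iint] evaluates in its base case. *)
  exists (dirac ((fun=> point) : prodn T 0)) => g mg bg /=.
  by rewrite integral_dirac ?diracT ?mul1e//; exact/measurable_EFinP.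
exists (image_prob (prod_prob pi Q) (@measurable_tcons n)) => g mg bg.
have [M gM] := bg.
rewrite integral_image_prob// integral_prod_prob/=; last 2 first.
- exact: measurableT_comp mg (@measurable_tcons n).
- by exists M => z; exact: gM.
apply: eq_integral => x _; rewrite IH//; last by exists M => z; exact: gM.
apply: (measurableT_comp mg).
exact: measurableT_comp (@measurable_tcons n) (pair1_measurable x).
Qed.

Definition powP pi n : probability (prodn T n) R := sval (cid (iint_prob pi n)).

Lemma IgE pi n (g : prodn T n -> R) : measurable_fun setT g -> fbounded g ->
  Ig g pi = (\int[powP pi n]_x g x)%:E.
Proof.
move=> mg bg; rewrite /Ig /powP; case: cid => Q /= ->//.
exact: EFin_Rintegral.
Qed.

Lemma pownE pi n (A : set (prodn T n)) : measurable A ->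
  pown pi A = powP pi n A.
Proof.
move=> mA; rewrite -[LHS]/(Ig (\1_A : prodn T n -> R) pi) IgE//.
- by rewrite Rintegral_indic// fineK// fin_num_measure.
- exact: fbounded_indic.
Qed.

Lemma measurable_tensor n (f : 'I_n -> T -> R) :
  (forall i, measurable_fun setT (f i)) ->
  measurable_fun setT (fun x : prodn T n => \prod_i f i (x i)).
Proof.
move=> mf; apply: measurable_prod => i _.
exact: measurableT_comp (mf i) (measurable_coord i).
Qed.

Lemma fbounded_tensor n (f : 'I_n -> T -> R) :
  (forall i, fbounded (f i)) ->
  fbounded (fun x : prodn T n => \prod_i f i (x i)).
Proof.
move=> /choice[M fM]; exists (\prod_i M i) => x.
by rewrite normr_prod; apply: ler_prod => i _; rewrite normr_ge0 fM.
Qed.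

(** The factor [c] strengthens the induction: once the first coordinate is fixed, [f ord0 x] is
    absorbed into it. *)
Lemma iint_tensor pi n (c : R) (f : 'I_n -> T -> R) :
  (forall i, measurable_fun setT (f i)) -> (forall i, fbounded (f i)) ->
  iint pi (fun x => (c * \prod_i f i (x i))%:E) =
  (c * \prod_i \int[pi]_x f i x)%:E.
Proof.
move=> + bf; elim: n => [|n IH] in c f bf * => mf; first by rewrite /= !big_ord0.
rewrite /= big_ord_recl.
under eq_integral => x _.
  under [X in iint _ X]eq_fun => y.
    rewrite big_ord_recl tcons0 mulrA.
    under eq_bigr do rewrite tconsS.
    over.
  rewrite (IH (c * f ord0 x) (fun i => f (lift ord0 i)))//.
  rewrite mulrAC.
  over.
rewrite (_ : (fun x => _) = fun x =>
  ((c * \prod_(i < n) \int[pi]_x0 f (lift ord0 i) x0) * f ord0 x)%:E)//.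
rewrite EFin_Rintegral ?bounded_RintegralZl//.
- by rewrite mulrAC mulrA.
- exact: measurable_funM.
- by apply: fboundedM => //; exact: fbounded_cst.
Qed.

Lemma powP_tensor pi n (f : 'I_n -> T -> R) :
  (forall i, measurable_fun setT (f i)) -> (forall i, fbounded (f i)) ->
  \int[powP pi n]_x (\prod_i f i (x i)) = \prod_i \int[pi]_x f i x.
Proof.
move=> mf bf; have := iint_tensor pi 1 mf bf.
under [X in iint _ X]eq_fun do rewrite mul1r.
rewrite mul1r => /(congr1 fine)/= <-.
rewrite -[RHS]/(fine (Ig (fun x : prodn T n => \prod_i f i (x i)) pi)) IgE//.
  exact: measurable_tensor.
exact: fbounded_tensor.
Qed.

Definition rect n (G : set (set T)) : set (set (prodn T n)) :=
  [set A | exists B : 'I_n -> set T, (forall i, G (B i)) /\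
    A = [set x | forall i, B i (x i)]].

Lemma measurable_rect n (B : 'I_n -> set T) : (forall i, measurable (B i)) ->
  measurable [set x : prodn T n | forall i, B i (x i)].
Proof.
move=> mB.
rewrite (_ : mkset _ =
  \bigcap_(i in [set: 'I_n]) ((fun x : prodn T n => x i) @^-1` B i)).
  apply: fin_bigcap_measurable => // i _; rewrite -[X in measurable X]setTI.
  exact: measurable_coord.
by apply/seteqP; split=> [x Bx i _|x Bx i]; exact: Bx.
Qed.

Lemma rect_setI n G : setI_closed G -> setI_closed (@rect n G).
Proof.
move=> GI _ _ [B [GB ->]] [C [GC ->]].
exists (fun i => B i `&` C i); split; first by move=> i; exact: GI.
by apply/seteqP; split=> [x [Bx Cx] i|x BCx]; split=> // i; have [] := BCx i.
Qed.

Lemma measurable_prodnE n G : @measurable _ T = <<s G >> -> G setT ->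
  @measurable _ (prodn T n) = <<s @rect n G >>.
Proof.
move=> mG GT; apply/seteqP; split; last first.
  apply: smallest_sub; first exact: sigma_algebra_measurable.
  move=> _ [B [GB ->]]; apply: measurable_rect => i.
  by rewrite mG; exact: sub_sigma_algebra.
apply: smallest_sub; first exact: smallest_sigma_algebra.
move=> _ [i [B [mB ->]]].
suff /(_ measurableT B mB) : @measurable_fun _ _
  (g_sigma_algebraType (@rect n G)) T setT (fun x => x i) by rewrite setTI.
apply: (measurability G) => // _ [C GC <-]; rewrite setTI.
(* A cylinder over one coordinate is a rectangle whose other sides are the whole space; this uses
   [G setT]. *)
apply: sub_sigma_algebra; exists (fun j => if j == i then C else setT); split.
  by move=> j; case: ifP.
apply/seteqP; split=> [x Cx j|x /(_ i)/=]; last by rewrite eqxx.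
by case: eqP => [->|].
Qed.

Lemma prodn_prob_unique n G (Q1 Q2 : probability (prodn T n) R) :
  @measurable _ T = <<s G >> -> setI_closed G -> G setT ->
  (forall A, rect G A -> Q1 A = Q2 A) -> forall A, measurable A -> Q1 A = Q2 A.
Proof.
move=> mG GI GT Q12 A mA.
apply: (measure_unique (@rect n G) (fun=> setT)) => //.
- exact: measurable_prodnE.
- exact: rect_setI.
- by move=> _; exists (fun=> setT); split=> //; apply/seteqP; split.
- by apply/seteqP; split=> // x _; exists 0%N.
- by move=> _; apply: fin_num_fun_lty; exact: fin_num_measure.
Qed.

Lemma indic_rect n (B : 'I_n -> set T) (x : prodn T n) :
  \1_[set x : prodn T n | forall i, B i (x i)] x = \prod_i \1_(B i) (x i) :> R.
Proof.
rewrite indicE; case: (boolP (_ \in _)) => [|]; rewrite ?notin_setE ?inE /=.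
  by move=> Bx; rewrite big1// => i _; rewrite indicE mem_set.
by move=> /existsNP[i NBi]; rewrite (bigD1 i)//= indicE memNset// mul0r.
Qed.

Lemma powP_rect pi n (B : 'I_n -> set T) : (forall i, measurable (B i)) ->
  powP pi n [set x | forall i, B i (x i)] = (\prod_i fine (pi (B i)))%:E.
Proof.
move=> mB; have mR := measurable_rect mB.
have bB (A : set T) : fbounded (\1_A : T -> R).
  exact: fbounded_indic.
rewrite -[LHS]fineK ?fin_num_measure// -Rintegral_indic//; congr EFin.
under eq_Rintegral do rewrite indic_rect.
rewrite (powP_tensor pi (f := fun i => \1_(B i)))//.
by apply: eq_bigr => i _; rewrite Rintegral_indic.
Qed.

Lemma measurable_evalp (A : set T) : measurable A ->
  measurable_fun setT (fun pi : pprobability T R => (pi : probability T R) A).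
Proof.
move=> mA.
apply: (measurable_kernel (kprobability (@measurable_id _ (pprobability T R) setT))).
exact: mA.
Qed.

Lemma measurable_powP n (A : set (prodn T n)) : measurable A ->
  measurable_fun setT (fun pi : pprobability T R => powP pi n A).
Proof.
apply: (@measurable_prob_pi_system R _ (pprobability T R) _ (prodn T n)
  (fun pi => powP pi n) (@rect n measurable)).
- apply: measurable_prodnE => //.
  by apply/esym; apply: sigma_algebra_id; exact: sigma_algebra_measurable.
- by apply: rect_setI; exact: measurableI.
move=> _ [B [mB ->]]; under eq_fun do rewrite powP_rect//.
apply/measurable_EFinP; apply: measurable_prod => i _.
by apply: measurableT_comp => //; exact: measurable_evalp.
Qed.

End prodn.

(** * Mixtures are extendible *)

Section mixture.
Context d (T : measurableType d) {R : realType}.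

Lemma measurable_reindex n N (s : 'I_n -> 'I_N) : measurable_fun setT
  (fun x : prodn T N => (fun i => x (s i)) : prodn T n).
Proof. by apply: measurable_fun_prodn => i; exact: measurable_coord. Qed.

(** Serves twice: a permutation [s] gives exchangeability of the mixture of powers, and an initial
    inclusion [s] gives its marginal on the first [n] coordinates. *)
Lemma powP_reindex (pi : probability T R) n N (s : 'I_n -> 'I_N)
    (A : set (prodn T n)) : injective s -> measurable A ->
  powP pi N [set x | A (fun i => x (s i))] = powP pi n A.
Proof.
move=> sI; rewrite -[LHS](image_probE (powP pi N) (measurable_reindex s)).
move: A; apply: (prodn_prob_unique (G := measurable)) => //.
- by apply/esym; apply: sigma_algebra_id; exact: sigma_algebra_measurable.
- exact: measurableI.
move=> _ [B [mB ->]]; rewrite powP_rect//.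
(* By injectivity [B' j] is [B i] when [j = s i]; it is the whole space when [s] misses [j], and
   then contributes a factor 1. *)
pose B' j := [set t | forall i, s i = j -> B i t].
have B'1 i : B' (s i) = B i.
  by apply/seteqP; split=> [t /(_ i erefl)//|t Bt i' /sI ->].
have B'0 j : (forall i, s i != j) -> B' j = setT.
  by move=> sj; apply/seteqP; split=> // t _ i /eqP; rewrite (negbTE (sj i)).
have mB' j : measurable (B' j).
  have [[i <-]|sj] := pselect (exists i, s i = j); first by rewrite B'1; exact: mB.
  by rewrite B'0// => i; apply/eqP => sij; apply: sj; exists i.
have -> : image_prob (powP pi N) (measurable_reindex s)
    [set x | forall i, B i (x i)] = powP pi N [set x | forall j, B' j (x j)].
  rewrite image_probE; congr (powP pi N _); apply/seteqP; split=> x /=.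
    by move=> Bx j i <-; exact: Bx.
  by move=> Bx i; exact: (Bx (s i)).
rewrite powP_rect//; congr EFin.
rewrite [RHS](partition_big s xpredT)//=; apply: eq_bigr => j _.
have [[i <-]|sj] := pselect (exists i, s i = j).
  rewrite B'1 (eq_bigl (pred1 i)) ?big_pred1_eq// => k /=.
  exact: inj_eq.
have sj' i : s i != j by apply/eqP => sij; apply: sj; exists i.
by rewrite B'0// probability_setT big_pred0// => i; rewrite (negbTE (sj' i)).
Qed.

Variable nu : probability (pprobability T R) R.
Variable n : nat.
Local Open Scope ereal_scope.

Definition mixture (A : set (prodn T n)) : \bar R := \int[nu]_pi powP pi n A.

Let mixture0 : mixture set0 = 0.
Proof. by rewrite /mixture; under eq_integral do rewrite measure0; exact: integral0. Qed.

Let mixture_ge0 A : 0 <= mixture A.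
Proof. by apply: integral_ge0 => pi _; exact: measure_ge0. Qed.

Let mixture_sigma_additive : semi_sigma_additive mixture.
Proof.
move=> F mF tF mUF; rewrite [X in _ --> X](_ : _ = \sum_(i <oo) mixture (F i)).
  by apply: is_cvg_ereal_nneg_natsum => i _; exact: mixture_ge0.
rewrite /mixture -integral_nneseries//; last first.
  by move=> i; exact: measurable_powP.
apply: eq_integral => pi _; apply/esym/cvg_lim => //.
exact: measure_semi_sigma_additive.
Qed.

HB.instance Definition _ := isMeasure.Build _ _ _ mixture
  mixture0 mixture_ge0 mixture_sigma_additive.

Let mixtureT : mixture setT = 1.
Proof.
rewrite /mixture; under eq_integral do rewrite probability_setT.
by rewrite integral_cst// [X in _ * X]probability_setT mule1.
Qed.

HB.instance Definition _ := Measure_isProbability.Build _ _ _ mixture mixtureT.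

Definition mixtureP : probability (prodn T n) R := mixture.

Lemma mixturePE A : measurable A -> mixtureP A = \int[nu]_pi pown pi A.
Proof. by move=> mA; apply: eq_integral => pi _; rewrite pownE. Qed.

End mixture.

Lemma mixture_extendible {R : realType} d (T : measurableType d) (n : nat)
    dO (Omega : measurableType dO) (P : probability Omega R)
    (X : Omega -> prodn T n) (nu : probability (pprobability T R) R) :
  (forall A : set (prodn T n), measurable A ->
    P (X @^-1` A) = (\int[nu]_pi pown pi A)%E) ->
  forall (N : nat) (nN : (n <= N)%N), extendible P X nN.
Proof.
move=> Pnu N nN.
exists _, (prodn T N), (mixtureP nu N), id; split; first exact: measurable_id.
have msub (m : nat) (s : 'I_m -> 'I_N) (A : set (prodn T m)) : measurable A ->
    measurable [set x : prodn T N | A (fun i => x (s i))].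
  by move=> mA; rewrite -[X in measurable X]setTI; exact: (measurable_reindex s).
split=> [s A mA|A mA].
  apply: eq_integral => pi _; apply/esym; apply: powP_reindex mA.
  exact: perm_inj.
rewrite Pnu// -(mixturePE nu mA); apply: eq_integral => pi _.
apply: powP_reindex mA => i j /(congr1 val) /= ij; exact: val_inj.
Qed.

(** * Extendibility bounds the norm *)

Section empirical.
Context {R : realType} d (T : measurableType d) (N : nat) (x : 'I_N.+1 -> T).
Local Open Scope ereal_scope.

(** [msum] is indexed by [nat], hence [inord]; there are [N.+1] points so that the sample is
    nonempty. *)
Definition empirical : set T -> \bar R :=
  mscale (N.+1%:R^-1)%:nng%R (msum (fun k => \d_(x (inord k))) N.+1).

HB.instance Definition _ := Measure.on empirical.

Let empiricalT : empirical setT = 1.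
Proof.
rewrite /empirical /mscale/= /msum (eq_bigr (fun=> 1%:E)); last first.
  by move=> i _; exact: diracT.
rewrite sumEFin sumr_const card_ord -EFinM.
by rewrite mulVf// pnatr_eq0.
Qed.

HB.instance Definition _ := Measure_isProbability.Build _ _ _
  empirical empiricalT.

Lemma integral_empirical (f : T -> R) : measurable_fun setT f -> fbounded f ->
  \int[empirical]_t (f t)%:E = (N.+1%:R^-1 * \sum_k f (x k))%R%:E.
Proof.
move=> mf bf; have [M fM] := bf.
have ge0 (g : T -> R) : measurable_fun setT g -> (forall t, 0 <= g t)%R ->
    \int[empirical]_t (g t)%:E = (N.+1%:R^-1 * \sum_k g (x k))%R%:E.
  move=> mg g0; have mg' : measurable_fun setT (EFin \o g) by exact/measurable_EFinP.
  rewrite ge0_integral_mscale//=; last by move=> t _; rewrite lee_fin.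
  rewrite ge0_integral_measure_sum//; last by move=> t _; rewrite lee_fin.
  rewrite EFinM -sumEFin; congr (_ * _); apply: eq_bigr => i _.
  by rewrite integral_dirac// diracT mul1e inord_val.
rewrite (EFin_Rintegral (empirical : probability T R))//.
(* The formula is known for nonnegative functions; it is applied to [f + M], and the constant
   cancels because the weights sum to 1. *)
have mM : measurable_fun setT (fun t => f t + M)%R.
  exact: measurable_funD.
have bM : fbounded (fun t => f t + M)%R.
  by apply: fboundedD => //; exact: fbounded_cst.
have := ge0 _ mM; rewrite (EFin_Rintegral (empirical : probability T R))//.
rewrite (bounded_RintegralD (empirical : probability T R))//; last exact: fbounded_cst.
rewrite prob_Rintegral_cst big_split/= sumr_const card_ord mulrDr.
rewrite -(mulr_natl M) mulrA mulVf ?pnatr_eq0// mul1r.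
move=> h; congr EFin; apply: (@addIr _ M); apply: EFin_inj; apply: h => t.
by have := fM t; rewrite ler_norml => /andP[+ _]; rewrite -subr_ge0 opprK.
Qed.

(** Drawing from the empirical measure is sampling with replacement, so the average runs over all
    index maps, repetitions included. *)
Lemma iint_empirical n (g : prodn T n -> R) :
  measurable_fun setT g -> fbounded g ->
  iint (empirical : probability T R) (fun y => (g y)%:E) =
  (N.+1%:R^-1 ^+ n *
   \sum_(s : {ffun 'I_n -> 'I_N.+1}) g (fun i => x (s i)))%R%:E.
Proof.
elim: n => [|n IH] in g * => mg bg.
  rewrite (eq_bigr (fun=> g (fun=> point))); last first.
    by move=> s _; congr g; apply/funext => -[].
  by rewrite sumr_const card_ffun !card_ord expn0 mulr1n expr0 mul1r.
have [M gM] := bg.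
have mtc t : measurable_fun setT (fun y : prodn T n => g (tcons t y)).
  apply: (measurableT_comp mg).
  exact: measurableT_comp (@measurable_tcons _ T n) (pair1_measurable t).
have mtc' y : measurable_fun setT (fun t => g (tcons t (y : prodn T n))).
  apply: (measurableT_comp mg).
  exact: measurableT_comp (@measurable_tcons _ T n) (pair2_measurable y).
have -> : iint (empirical : probability T R) (fun y => (g y)%:E) =
    \int[empirical]_t (N.+1%:R^-1 ^+ n *
     \sum_(s : {ffun 'I_n -> 'I_N.+1}) g (tcons t (fun i => x (s i))))%R%:E.
  apply: eq_integral => t _; apply: (IH _ (mtc t)).
  by exists M => y; exact: gM.
rewrite integral_empirical; last 2 first.
- apply: measurable_funM => //; apply: measurable_sum => s.
  exact: mtc'.
- apply: fboundedM; first exact: fbounded_cst.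
  exists (\sum_(s : {ffun 'I_n -> 'I_N.+1}) M)%R => t.
  by apply: le_trans (ler_norm_sum _ _ _) _; apply: ler_sum => s _; exact: gM.
rewrite -mulr_sumr mulrA -exprS; congr (_ * _)%R%:E.
rewrite pair_big/= [RHS](reindex (fun p : 'I_N.+1 * {ffun 'I_n -> 'I_N.+1} =>
  [ffun i => tcons p.1 p.2 i]))/=.
  apply: eq_bigr => -[k s] _ /=; congr g; apply/funext => i.
  by rewrite ffunE; have [j ->|->] := unliftP ord0 i; rewrite !(tconsS, tcons0).
exists (fun s => (s ord0, [ffun j => s (lift ord0 j)])) => [[k s]|s] _ /=.
  congr pair; first by rewrite ffunE tcons0.
  by apply/ffunP => j; rewrite !ffunE tconsS.
apply/ffunP => i; rewrite ffunE.
by have [j ->|->] := unliftP ord0 i; rewrite !(tconsS, tcons0)/= ?ffunE.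
Qed.

End empirical.

(** Exchangeability is stated for permutations, whereas the averaging argument produces injective
    index maps. The remaining [N - n] indices are sent, in order, to the enumeration [C] of the
    complement of the image. *)
Lemma perm_extending n N (nN : (n <= N)%N) (s : 'I_n -> 'I_N) : injective s ->
  exists p : 'S_N, forall i, p (widen_ord nN i) = s i.
Proof.
move=> sI; pose C := enum [pred j | j \notin codom s].
have sC : size C = (N - n)%N.
  rewrite -cardE; have := cardC (mem (codom s)).
  rewrite card_codom// !card_ord => e; rewrite -[X in (X - _)%N]e addKn.
  by apply: eq_card => j; rewrite !inE.
pose f (j : 'I_N) : 'I_N :=
  if insub (val j) is Some i then s i else nth j C (j - n).
have fwiden i : f (widen_ord nN i) = s i.
  by rewrite /f /= insubT//= => lt; congr s; exact: val_inj.
have fC (j : 'I_N) : (n <= j)%N -> f j = nth j C (j - n) /\ (j - n < size C)%N.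
  move=> nj; rewrite /f insubF; last by rewrite ltnNge nj.
  by split=> //; rewrite sC ltn_sub2r// (leq_ltn_trans nj).
have fs (j : 'I_N) (jn : (j < n)%N) : f j = s (Ordinal jn).
  by rewrite -fwiden; congr f; exact: val_inj.
have notC j i : (n <= nat_of_ord j)%N -> f j != s i.
  move=> nj; have [-> jC] := fC j nj; apply/eqP => e.
  by have := mem_nth j jC; rewrite mem_enum inE e codom_f.
have fI : injective f.
  move=> j k; have [jn|nj] := ltnP j n; have [kn|nk] := ltnP k n.
  - by rewrite (fs _ jn) (fs _ kn) => /sI [/val_inj].
  - by rewrite (fs _ jn) => /esym/eqP; rewrite (negbTE (notC _ _ nk)).
  - by rewrite (fs _ kn) => /eqP; rewrite (negbTE (notC _ _ nj)).
  - have [-> jC] := fC _ nj; have [-> kC] := fC _ nk.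
    rewrite (set_nth_default j)// => /eqP; rewrite nth_uniq ?enum_uniq//.
    move=> /eqP e; apply: val_inj => /=.
    by rewrite -(subnK nj) e subnK.
by exists (perm fI) => i; rewrite permE fwiden.
Qed.

(** A form without division or subtraction of the fact that at most a proportion [n * n / N] of the
    maps from [n] to [N] points fails to be injective. *)
Lemma ffact_expn_bound n N : (N ^ n * N <= N ^_ n * N + n * n * N ^ n)%N.
Proof.
elim: n => [|n IH]; first by rewrite expn0 ffactn0 muln0 addn0.
rewrite ffactnSr expnS.
have [Nn|nN] := leqP N n.
  rewrite (leq_trans _ (leq_addl _ _))//.
  by rewrite mulnC leq_mul2r; apply/orP; right; nia.
have h : (N ^_ n * (N - n) = N ^_ n * N - N ^_ n * n)%N by rewrite mulnBr.
have fe : (N ^_ n <= N ^ n)%N.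
  elim: n {IH nN h} => [|n IH]; first by rewrite expn0 ffactn0.
  by rewrite ffactnSr expnS mulnC leq_mul// leq_subr.
have le : (N ^_ n * n <= N ^_ n * N)%N by rewrite leq_mul2l (ltnW nN) orbT.
rewrite h.
move: (N ^_ n)%N (N ^ n)%N IH fe le {h} => a b IH fe le.
have IH' : (b * N * N <= a * N * N + n * n * b * N)%N.
  by rewrite -mulnDl leq_mul2r IH orbT.
have fe' : (a * n * N <= b * n * N)%N by rewrite !leq_mul2r fe !orbT.
rewrite mulnBl; move: IH' fe' (leq_mul le (leqnn N)) => IH' fe' le'.
rewrite -(leq_add2r (a * n * N)).
rewrite addnAC subnK//.
nia.
Qed.

Section extendible_bound.
Context {R : realType} d (T : measurableType d) (n : nat).
Context dO (Omega : measurableType dO) (P : probability Omega R).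
Variable X : Omega -> prodn T n.
Hypothesis mX : measurable_fun setT X.

Lemma extendible_reindex N (nN : (n <= N)%N) dO' (Omega' : measurableType dO')
    (Q : probability Omega' R) (Y : Omega' -> prodn T N)
    (s : 'I_n -> 'I_N) (g : prodn T n -> R) :
  measurable_fun setT Y -> exchangeable Q Y ->
  (forall A : set (prodn T n), measurable A ->
    Q ((fun w => (fun i => Y w (widen_ord nN i)) : prodn T n) @^-1` A) =
    P (X @^-1` A)) ->
  injective s -> measurable_fun setT g -> fbounded g ->
  \int[Q]_w g (fun i => Y w (s i)) = \int[P]_w g (X w).
Proof.
move=> mY eY YX sI mg bg.
have mYs : measurable_fun setT (fun w => (fun i => Y w (s i)) : prodn T n).
  exact: measurableT_comp (measurable_reindex s) mY.
rewrite -(Rintegral_image_prob _ mYs)// -(Rintegral_image_prob _ mX)//.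
congr fine; apply: eq_measure_integral => A mA _.
rewrite [LHS]image_probE [RHS]image_probE -YX//.
have [p ps] := perm_extending nN sI.
have mA' : measurable [set y : prodn T N | A (fun i => y (widen_ord nN i))].
  by rewrite -[X in measurable X]setTI; exact: (measurable_reindex (widen_ord nN)).
rewrite -[RHS]/(Q (Y @^-1` [set y : prodn T N | A (fun i => y (widen_ord nN i))])).
rewrite (eY p _ mA'); congr (Q _); apply/funext => w /=.
by congr A; apply/funext => i; rewrite ps.
Qed.

(* Average the bound [|I(g, pi)| <= 1] over the empirical measures of the
   extension: all but a proportion [n^2 / N] of the index maps are injective. *)
Lemma extendible_bound N (nN : (n <= N.+1)%N) (g : prodn T n -> R) M :
  extendible P X nN -> measurable_fun setT g -> (forall x, `|g x| <= M) ->
  (forall pi : probability T R, (`| Ig g pi | <= 1)%E) ->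
  `|\int[P]_w g (X w)| <= 1 + 2 * M * (n * n)%:R / N.+1%:R.
Proof.
move=> -[dU [U [Q [Y [mY [eY YX]]]]]] mg gM Ig1.
have bg : fbounded g by exists M.
have M0 : 0 <= M by apply: le_trans (gM (X point)).
pose F := {ffun 'I_n -> 'I_N.+1}.
set e := \int[P]_w g (X w).
have eM : `|e| <= M.
  by apply: norm_Rintegral_le => //; exact: measurableT_comp.
pose G (s : F) w := g (fun i => Y w (s i)).
have mG s : measurable_fun setT (G s).
  by apply: (measurableT_comp mg); exact: measurableT_comp (measurable_reindex s) mY.
have bG s w : `|G s w| <= M by exact: gM.
(* The hypothesis on [g] is used at the empirical measure of the realization [Y w]. *)
have sumG w : `|\sum_s G s w| <= N.+1%:R ^+ n.
  have := Ig1 (empirical (Y w)); rewrite /Ig iint_empirical//= lee_fin.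
  by rewrite normrM normrX normfV normr_nat exprVn ler_pdivrMl ?mulr1// exprn_gt0.
have int_sum : \sum_s \int[Q]_w G s w = \int[Q]_w \sum_s G s w.
  rewrite [RHS](_ : _ = \int[Q]_w \sum_(i < #|F|) G (nth [ffun=> ord0] (enum F) i) w).
    rewrite (bounded_Rintegral_sum _
      (f_ := fun i => G (nth [ffun=> ord0] (enum F) i)))//; last first.
      by move=> i; exists M => w; exact: bG.
    rewrite -(big_mkord xpredT (fun i => \int[Q]_w G (nth [ffun=> ord0] (enum F) i) w)).
    by rewrite cardE -(big_nth [ffun=> ord0] xpredT (fun s => \int[Q]_w G s w)) big_enum.
  apply: eq_Rintegral => w _.
  rewrite -(big_mkord xpredT (fun i => G (nth [ffun=> ord0] (enum F) i) w)).
  by rewrite cardE -(big_nth [ffun=> ord0] xpredT (fun s => G s w)) big_enum.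
have bound : `|\sum_s \int[Q]_w G s w| <= N.+1%:R ^+ n.
  rewrite int_sum; apply: norm_Rintegral_le => //.
  by apply: measurable_sum.
pose inj := [set s : F | injectiveb s]%SET.
have cinj : #|inj| = (N.+1 ^_ n)%N by rewrite card_inj_ffuns !card_ord.
have ciC : (N.+1 ^_ n + #|~: inj| = N.+1 ^ n)%N.
  by rewrite -cinj cardsC card_ffun !card_ord.
(* Every term is compared with [e]: injective maps give exactly [e], and each other map deviates by
   at most [2 * M], the source of that factor in the bound. *)
have split_sum : \sum_s \int[Q]_w G s w =
    (N.+1 ^ n)%:R * e + \sum_(s in ~: inj) (\int[Q]_w G s w - e).
  rewrite -ciC natrD -cinj sumrB sumr_const -mulr_natl.
  rewrite [RHS](_ : _ = #|inj|%:R * e + \sum_(s in ~: inj) \int[Q]_w G s w);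
    last by ring.
  rewrite (bigID (mem inj))/=; congr (_ + _); last first.
    by apply: eq_bigl => s; rewrite !inE.
  rewrite mulr_natl -sumr_const; apply: eq_bigr => s; rewrite inE => /injectiveP sI.
  exact: (extendible_reindex mY eY YX sI).
have rest : `|\sum_(s in ~: inj) (\int[Q]_w G s w - e)| <= #|~: inj|%:R * (2 * M).
  apply: le_trans (ler_norm_sum _ _ _) _; rewrite mulr_natl -sumr_const.
  apply: ler_sum => s _; apply: le_trans (ler_normB _ _) _.
  rewrite mulr_natl mulr2n; apply: lerD => //.
  exact: norm_Rintegral_le.
have K0 : 0 < (N.+1 ^ n)%:R :> R by rewrite ltr0n expn_gt0.
have h1 : (N.+1 ^ n)%:R * `|e| <= (N.+1 ^ n)%:R + #|~: inj|%:R * (2 * M).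
  rewrite -[X in X * _]gtr0_norm// -normrM.
  rewrite (_ : _ * e = \sum_s \int[Q]_w G s w -
    \sum_(s in ~: inj) (\int[Q]_w G s w - e)); last by rewrite split_sum addrK.
  apply: le_trans (ler_normB _ _) _; apply: lerD => //.
  by rewrite natrX.
have h2 : #|~: inj|%:R * N.+1%:R <= (n * n)%:R * (N.+1 ^ n)%:R :> R.
  rewrite -!natrM ler_nat; have := ffact_expn_bound n N.+1.
  by rewrite -{1}ciC mulnDl leq_add2l.
rewrite -(ler_pM2l K0); apply: le_trans h1 _.
rewrite mulrDr mulr1 lerD2l.
rewrite [leRHS](_ : _ = (n * n)%:R * (N.+1 ^ n)%:R * (2 * M) / N.+1%:R);
  last by ring.
rewrite ler_pdivlMr ?ltr0n// mulrAC.
by apply: ler_wpM2r => //; rewrite mulr_ge0.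
Qed.

End extendible_bound.

(** The constant 1 is admissible with expectation 1, so the supremum is always at least 1 and only
    the upper bound carries information. *)
Lemma Tnorm_eq1 {R : realType} d (T : measurableType d) (n : nat)
    dO (Omega : measurableType dO) (P : probability Omega R)
    (X : Omega -> prodn T n) : measurable_fun setT X ->
  Tnorm P X = 1%E <->
  forall g : prodn T n -> R, measurable_fun setT g -> fbounded g ->
    (forall pi : probability T R, (`| Ig g pi | <= 1)%E) ->
    `|\int[P]_w g (X w)| <= 1.
Proof.
move=> mX.
have EI (g : prodn T n -> R) : measurable_fun setT g -> fbounded g ->
    (`| \int[P]_w (g (X w))%:E | = `|\int[P]_w g (X w)|%:E)%E.
  move=> mg [M gM]; rewrite (EFin_Rintegral P (f := fun w => g (X w)))//.
    exact: measurableT_comp.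
  by exists M => w; exact: gM.
split=> [T1 g mg bg Ig1|H].
  rewrite -lee_fin -EI// -T1; apply: ereal_sup_ubound.
  by exists g => //; split=> //; split.
apply/eqP; rewrite eq_le; apply/andP; split.
  apply: ge_ereal_sup => _ [g [mg [bg Ig1]] <-].
  by rewrite EI// lee_fin; exact: H.
apply: ereal_sup_ubound; exists (fun=> 1); last first.
  by rewrite (EFin_Rintegral P (f := fun=> 1))//= ?prob_Rintegral_cst ?normr1//;
    exact: fbounded_cst.
split=> //; split; first exact: fbounded_cst.
move=> pi; rewrite IgE//; last exact: fbounded_cst.
by rewrite prob_Rintegral_cst/= normr1.
Qed.

Lemma extendible_Tnorm {R : realType} d (T : measurableType d) (n : nat)
    dO (Omega : measurableType dO) (P : probability Omega R)
    (X : Omega -> prodn T n) : measurable_fun setT X ->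
  (forall (N : nat) (nN : (n <= N)%N), extendible P X nN) -> Tnorm P X = 1%E.
Proof.
move=> mX ext; apply/(Tnorm_eq1 P mX) => g mg [M gM] Ig1.
apply/ler_addgt0Pr => e e0.
(* The summand [n] makes [N.+1] a legitimate extension length; the other one makes
   [C / N.+1 <= e]. *)
pose C := 2 * M * (n * n)%:R; pose N := (n + Num.truncn (C / e))%N.
have nN : (n <= N.+1)%N by rewrite /N -addnS leq_addr.
apply: le_trans (extendible_bound mX (ext _ nN) mg gM Ig1) _.
rewrite lerD2l ler_pdivrMr ?ltr0n// -ler_pdivrMl// mulrC.
apply: le_trans (ltW (truncnS_gt _)) _.
by rewrite ler_nat ltnS leq_addl.
Qed.

(** * Riesz representation for Baire probabilities *)

Lemma positivity_measurable_fun {R : realType} d (T : measurableType d)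
    (L : set (T -> R)) f : function_algebra L ->
  positivity_sets L `<=` measurable -> L f -> measurable_fun setT f.
Proof.
move=> LA Lm Lf; apply: (measurability _ (RGenOInfty.measurableE R)).
move=> _ [_ [x ->] <-]; rewrite setTI; apply: Lm.
exists (fun y => f y - x); first by apply: (fa_sub LA) => //; exact: fa_cst.
by apply/seteqP; split => y /=; rewrite in_itv/= andbT subr_gt0.
Qed.

Section compactly_supported.
Context {R : realType} {S : ptopologicalType}.
Implicit Types f g h : S -> R.

Lemma cc_fun_sub f g h : continuous h -> cc_fun f -> cc_fun g ->
  (forall x, h x != 0 -> f x != 0 \/ g x != 0) -> cc_fun h.
Proof.
move=> ch [_ cf] [_ cg] hfg; split=> //.
apply: (subclosed_compact (@closed_closure _ _) (compactU cf cg)).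
by rewrite -closureU; exact: closureS.
Qed.

Lemma cc_fun_closed f (K : set S) : continuous f -> compact K -> closed K ->
  (forall x, ~ K x -> f x = 0) -> cc_fun f.
Proof.
move=> cf cK clK f0; split=> //.
apply: (subclosed_compact (@closed_closure _ _) cK).
rewrite [X in _ `<=` X](closure_id K).1//; apply: closureS => x /= fx.
by apply: contrapT => /f0 f0x; rewrite f0x eqxx in fx.
Qed.

Lemma cc_fun0 : cc_fun (fun _ : S => 0 : R).
Proof.
split; first exact: cst_continuous.
rewrite (_ : mkset _ = set0) ?closure0; first exact: compact0.
by apply/seteqP; split=> // x /=; rewrite eqxx.
Qed.

Lemma cc_fun_bounded f : cc_fun f -> fbounded f.
Proof.
move=> [cf Kf]; have : compact (f @` closure [set x | f x != 0]).
  by apply: continuous_compact => //; exact: continuous_subspaceT.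
move=> /compact_bounded [M [_ fM]].
exists (`|M| + 1) => x; have [->|fx] := eqVneq (f x) 0; first by rewrite normr0.
apply: fM; first by rewrite (le_lt_trans (ler_norm M))// ltrDl.
by exists x => //; exact: subset_closure.
Qed.

(* The unitization of [C_c(S)], i.e. continuous functions on the one-point
   compactification. *)
Definition cc1 : set (S -> R) := [set f | exists c, cc_fun (fun x => f x - c)].

Lemma cc1_continuous f : cc1 f -> continuous f.
Proof.
move=> [c [cf _]] x; rewrite (_ : f = (fun y => (f y - c) + c)); last first.
  by apply/funext => y; rewrite subrK.
by apply: cvgD; [exact: cf|exact: cvg_cst].
Qed.

Lemma cc_cc1 f : cc_fun f -> cc1 f.
Proof. by move=> ccf; exists 0; under eq_fun do rewrite subr0. Qed.

(** The subtracted constant acts as the value at infinity: it follows sums, products and positive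
    parts, which dictates each witness. *)
Lemma function_algebra_cc1 : function_algebra cc1.
Proof.
split.
- by move=> c; exists c; under eq_fun do rewrite subrr; exact: cc_fun0.
- move=> f g cf cg; have [a fa] := cf; have [b gb] := cg.
  exists (a + b); apply: cc_fun_sub fa gb _.
    move=> x; apply: cvgB; last exact: cvg_cst.
    by apply: cvgD; exact: cc1_continuous.
  move=> x; have [fa0|] := eqVneq (f x - a) 0; last by left.
  by rewrite opprD addrACA fa0 add0r; right.
- move=> f g cf cg; have [a fa] := cf; have [b gb] := cg.
  exists (a * b); apply: cc_fun_sub fa gb _.
    move=> x; apply: cvgB; last exact: cvg_cst.
    by apply: cvgM; exact: cc1_continuous.
  move=> x; have [->|fxa] := eqVneq (f x) a; last by left; rewrite subr_eq0.
  rewrite -mulrBr => h; right; apply: contra_neq h => ->.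
  by rewrite mulr0.
- move=> f cf; have [a fa] := cf.
  exists (Num.max a 0); apply: (cc_fun_sub _ fa fa).
    move=> x; apply: cvgB; last exact: cvg_cst.
    apply: continuous_max; first exact: cc1_continuous.
    exact: cst_continuous.
  by move=> x; rewrite !subr_eq0 => h; left; apply: contra_neq h => ->.
- move=> f [c cf]; rewrite (_ : f = (fun y => (f y - c) + c)); last first.
    by apply/funext => y; rewrite subrK.
  by apply: fboundedD; [exact: cc_fun_bounded|exact: fbounded_cst].
Qed.

Lemma measurable_cc1 f : cc1 f -> measurable_fun (setT : set (baire R S)) f.
Proof.
move=> [c ccf]; apply: (eq_measurable_fun (fun y : baire R S => (f y - c) + c)).
  by move=> y _; rewrite subrK.
apply: measurable_funD => // _ B mB; rewrite setTI.
by apply: sub_sigma_algebra; exists (fun y => f y - c); split=> //; exists B.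
Qed.

(** Unlike the defining generators, positivity sets are stable under intersection and are increasing
    limits of ramps, as both Daniell-Stone and the uniqueness arguments require. *)
Lemma measurable_baireE : @measurable _ (baire R S) = <<s positivity_sets cc1 >>.
Proof.
apply/seteqP; split; apply: smallest_sub.
- exact: smallest_sigma_algebra.
- move=> _ [f [ccf [B [mB ->]]]].
  suff /(_ measurableT B mB) : @measurable_fun _ _
    (g_sigma_algebraType (positivity_sets cc1)) _ setT f by rewrite setTI.
  apply: (@positivity_measurable_fun R _
    (g_sigma_algebraType (positivity_sets cc1)) cc1 f function_algebra_cc1).
    exact: sub_sigma_algebra.
  exact: cc_cc1.
- exact: sigma_algebra_measurable.
- move=> _ [f Lf ->].
  rewrite (_ : mkset _ = f @^-1` `]0, +oo[%classic); last first.
    by apply/seteqP; split=> x /=; rewrite in_itv/= andbT.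
  by rewrite -[X in measurable X]setTI; exact: (measurable_cc1 Lf).
Qed.

Lemma dini (K : set S) (f_ : nat -> S -> R) : compact K ->
  (forall n, continuous (f_ n)) -> (forall n x, f_ n.+1 x <= f_ n x) ->
  (forall x e, 0 < e -> exists n, f_ n x < e) ->
  forall e, 0 < e -> exists n, forall x, K x -> f_ n x < e.
Proof.
move=> /compact_near_coveringP cK cf df f0 e e0.
have mono m n x : (m <= n)%N -> f_ n x <= f_ m x.
  move=> /subnK <-; elim: (n - m)%N => // k IH.
  by rewrite addSn; apply: le_trans (df _ _) IH.
suff [N _ KN] : \forall n \near \oo, K `<=` (fun x => f_ n x < e).
  by exists N => x; exact: (KN N (leqnn N)).
apply: (cK _ _ (fun n x => f_ n x < e)).
move=> x Kx; have [m fm] := f0 x _ e0.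
have nm : \forall y \near x, f_ m y < e by apply: (cvgr_lt (f_ m x)) => //; exact: cf.
exists ([set y | f_ m y < e], [set n | (m <= n)%N]) => /=.
  by split=> //; exists m.
by move=> [y n] /= [fy mn]; exact: le_lt_trans (mono _ _ _ mn) fy.
Qed.

(** The second hypothesis keeps mass from escaping: on the real line, the value at infinity is a
    positive normalized functional on [cc1] that no probability represents. *)
Lemma riesz_baire (Phi : (S -> R) -> R) : positive_functional cc1 Phi ->
  (forall e, 0 < e -> exists f, [/\ cc_fun f, forall x, 0 <= f x <= 1 &
    1 - e <= Phi f]) ->
  exists pi : probability (baire R S) R,
    forall f, cc1 f -> \int[pi]_x f x = Phi f.
Proof.
move=> PPhi tPhi; have LA := function_algebra_cc1.
have [||mu muE] := @daniell_stone R _ (baire R S) cc1 Phi LA PPhi; last 2 first.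
- by rewrite measurable_baireE.
- by exists mu => f cf; apply: muE => //; exact: measurable_cc1.
move=> f_ Lf df f0 fcvg e e0.
have [M fM] := fa_bounded LA (Lf 0%N).
pose M1 := `|M| + 1; have M1p : 0 < M1 by rewrite ltr_pwDr.
have f_M1 n x : f_ n x <= M1.
  apply: (@le_trans _ _ (f_ 0%N x)); last first.
    apply: le_trans (ler_norm _) (le_trans (fM x) _).
    by rewrite /M1 (le_trans (ler_norm M))// lerDl.
  by elim: n => // n IH; apply: le_trans (df _ _) IH.
have [|g [ccg g01 Pg]] := tPhi (e / 2 / M1); first by rewrite !divr_gt0.
have e2 : 0 < e / 2 by rewrite divr_gt0.
have [|n Kn] := dini ccg.2 _ df fcvg e2; first by move=> n; exact: cc1_continuous.
exists n.
have L1g : cc1 (fun x => 1 - g x) by apply: fa_sub => //; [exact: fa_cst|exact: cc_cc1].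
have L2 : cc1 (fun x => M1 * (1 - g x)) by exact: fa_scale.
(* This function dominates [f_ n]: Dini gives [f_ n < e / 2] on the support of [g], and where [g]
   vanishes the bound [M1] takes over. The choice of [g] makes the second term cost at most
   [e / 2]. *)
apply: (@le_trans _ _ (Phi (fun x => e / 2 + M1 * (1 - g x)))).
  apply: (pf_le LA PPhi) => //; first by apply: fa_add => //; exact: fa_cst.
  move=> x; have /andP[g0 g1] := g01 x.
  have [gx|gx] := eqVneq (g x) 0.
    by rewrite gx subr0 mulr1; have := f_M1 n x; lra.
  have : f_ n x < e / 2 by apply: Kn; exact: subset_closure.
  have : 0 <= M1 * (1 - g x) by rewrite mulr_ge0 ?subr_ge0// ltW.
  lra.
rewrite (pf_add PPhi)//; last exact: fa_cst.
rewrite (pf_cst LA PPhi) (pf_scale PPhi)// (pf_sub LA PPhi)//; last 2 first.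
- exact: fa_cst.
- exact: cc_cc1.
rewrite (pf_one PPhi).
have : M1 * (1 - Phi g) <= M1 * (e / 2 / M1) by apply: ler_wpM2l; [exact: ltW|lra].
by rewrite mulrCA mulfV ?gt_eqF// mulr1; lra.
Qed.

Hypothesis S_hausdorff : hausdorff_space S.
Hypothesis S_lc : locally_compact [set: S].

Lemma point_cc_fun (x : S) : exists f, [/\ cc_fun f, forall y, 0 <= f y <= 1 &
  f x = 1].
Proof.
have [U Ux [cU clU]] := S_lc (Logic.I : [set: S] x).
have nU : nbhs x U by move: Ux; rewrite /within/=; apply: filterS => y; exact.
have /(uniform_separatorP (R := R)) [g [cg g01 gx gU]] :
    uniform_separator [set x] (~` U°).
  apply: (@locally_compact_completely_regular S R S_lc S_hausdorff).
    exact: open_closedC (open_interior _).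
  by apply; exact: nU.
exists (fun y => 1 - g y); split.
- apply: (cc_fun_closed _ cU clU).
    by move=> y; apply: cvgB; [exact: cvg_cst|exact: cg].
  move=> y NUy; have -> : g y = 1.
    by apply: gU; exists y => // /interior_subset.
  by rewrite subrr.
- move=> y; have /= := g01 (g y) (ex_intro2 _ _ y Logic.I erefl).
  by rewrite in_itv/= => /andP[]; lra.
- have -> : g x = 0 by apply: gx; exists x.
  by rewrite subr0.
Qed.

(** In place of a finite subcover, near-covering compactness is applied to the filter of
    sufficiently large nonnegative functions of compact support; sums make it a filter. This yields
    [f > 1/2] on [K], which is doubled and truncated at 1. *)
Lemma compact_cc_fun (K : set S) : compact K -> exists f,
  [/\ cc_fun f, forall y, 0 <= f y <= 1 & forall x, K x -> f x = 1].
Proof.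
move=> /compact_near_coveringP cK.
pose D := [set f : S -> R | cc_fun f /\ forall x, 0 <= f x].
pose B f := [set h : S -> R | D h /\ forall x, f x <= h x].
have FF : Filter (filter_from D B).
  apply: filter_from_filter.
    by exists (fun=> 0); split=> //; exact: cc_fun0.
  move=> f g [ccf f0] [ccg g0]; exists (fun x => f x + g x).
    split=> [|x]; last by rewrite addr_ge0.
    apply: (cc_fun_sub _ ccf ccg).
      by move=> x; apply: cvgD; [exact: ccf.1|exact: ccg.1].
    move=> x; have [->|] := eqVneq (f x) 0; last by left.
    by rewrite add0r; right.
  move=> h [Dh fgh]; split; split=> // x; apply: le_trans (fgh x).
    by rewrite lerDl.
  by rewrite lerDr.
have [f Df Bf] : filter_from D B (fun h => K `<=` (fun x => 2^-1 < h x)).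
  apply: (cK _ (filter_from D B) (fun h x => 2^-1 < h x)) => x Kx.
  have [f [ccf f01 fx]] := point_cc_fun x.
  have Df : D f by split=> // y; case/andP: (f01 y).
  exists ([set y | 2^-1 < f y], B f) => /=.
    split; last by exists f.
    apply: (cvgr_gt (f x)); first exact: ccf.1.
    by rewrite fx; lra.
  by move=> [y h] /= [fy [_ fh]]; exact: lt_le_trans (fh y).
have Kf : K `<=` (fun x => 2^-1 < f x) by exact: Bf.
have [ccf f0] := Df.
exists (fun x => Num.min 1 (2 * f x)); split.
- apply: (cc_fun_sub _ ccf ccf).
    apply: (@cc1_continuous (fun x => Num.min 1 (2 * f x))).
    have LA := function_algebra_cc1.
    by apply: fa_min => //; [exact: fa_cst|apply: fa_scale => //; exact: cc_cc1].
  move=> x; have [->|] := eqVneq (f x) 0; last by left.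
  by rewrite mulr0 (min_idPr ler01) eqxx.
- by move=> x; rewrite le_min ler01 ge_min lexx/= andbT mulr_ge0.
- by move=> x /Kf fx; apply/min_idPl; lra.
Qed.

Lemma tight_cc_fun (mu : probability (baire R S) R) : tight mu ->
  forall e, 0 < e -> exists f, [/\ cc_fun f, forall x, 0 <= f x <= 1 &
    1 - e <= \int[mu]_x f x].
Proof.
move=> tmu e e0; have [K [cK [mK muK]]] := tmu _ e0.
have [f [ccf f01 fK]] := compact_cc_fun cK; exists f; split=> //.
have mf : measurable_fun (setT : set (baire R S)) f.
  by apply: measurable_cc1; exact: cc_cc1.
have : \int[mu]_x \1_K x <= \int[mu]_x f x.
  apply: bounded_le_Rintegral => //.
  - exact: fbounded_indic.
  - exact: cc_fun_bounded.
  - move=> x; rewrite indicE.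
    case: (boolP (x \in K)) => [|_]; last by case/andP: (f01 x).
    by rewrite inE => /fK ->.
rewrite Rintegral_indic//; apply: le_trans.
by rewrite -lee_fin fineK// fin_num_measure.
Qed.

End compactly_supported.

(** * From the norm bound to a mixture *)

Lemma ultra_bounded_cvg {R : realType} {T : Type} (G : set_system T)
    (phi : T -> R) : UltraFilter G -> fbounded phi ->
  exists l : R, phi @ G --> l.
Proof.
move=> UG [M phiM]; have PG : ProperFilter G by exact: ultra_proper.
have cM : compact `[- M, M]%classic by exact: segment_compact.
have [|l [_ cl]] := cM (phi @ G) _.
  by rewrite /= nbhs_simpl; apply: filterE => t /=; rewrite in_itv/= -ler_norml.
exists l => V Vl; have [//|GV] := in_ultra_setVsetC (phi @^-1` V) UG.
by have [y [/= NVy Vy]] := cl (~` V) V GV Vl.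
Qed.

Lemma function_algebra_fbounded {R : realType} {T : Type} :
  function_algebra (@fbounded R T).
Proof.
split=> //; [exact: fbounded_cst|exact: fboundedD|exact: fboundedM|].
move=> f [M fM]; exists M => x; have := fM x; rewrite !ler_norml => /andP[h1 h2].
by rewrite ge_max le_max h1 h2/=; lra.
Qed.

Lemma positive_functional_sub {R : realType} {T : Type} (L L' : set (T -> R)) I :
  L `<=` L' -> positive_functional L' I -> positive_functional L I.
Proof.
move=> LL' [ID IZ I1 I0]; split=> //.
- by move=> f g /LL' Lf /LL' Lg; exact: ID.
- by move=> c f /LL'; exact: IZ.
- by move=> f /LL'; exact: I0.
Qed.

Lemma fa_prod {R : realType} {T : Type} (L : set (T -> R)) I (r : seq I)
    (f_ : I -> T -> R) : function_algebra L -> (forall i, L (f_ i)) ->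
  L (fun x => \prod_(i <- r) f_ i x).
Proof.
move=> LA Lf; elim: r => [|i r IH].
  by under eq_fun do rewrite big_nil; exact: fa_cst.
by under eq_fun do rewrite big_cons; exact: fa_mul.
Qed.

Lemma cvg_prodr {R : realType} I (r : seq I) (u : I -> nat -> R) (l : I -> R) :
  (forall i, u i @ \oo --> l i) ->
  (fun k => \prod_(i <- r) u i k) @ \oo --> \prod_(i <- r) l i.
Proof.
move=> ul; elim: r => [|i r IH].
  by rewrite big_nil; under eq_fun do rewrite big_nil; exact: cvg_cst.
by rewrite big_cons; under eq_fun do rewrite big_cons; exact: cvgM.
Qed.

(** * The finitely additive mixing functional *)

Section Tnorm_functional.
Context {R : realType} d (T : measurableType d) (n : nat).
Context dO (Omega : measurableType dO) (P : probability Omega R).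
Variable X : Omega -> prodn T n.
Hypothesis mX : measurable_fun setT X.
Hypothesis T1 : Tnorm P X = 1%E.

Let admissible (g : prodn T n -> R) := measurable_fun setT g /\ fbounded g.
Let I (g : prodn T n -> R) (pi : probability T R) := \int[powP pi n]_x g x.
Let E (g : prodn T n -> R) := \int[P]_w g (X w).

Let admX g : admissible g ->
  measurable_fun setT (fun w => g (X w)) /\ fbounded (fun w => g (X w)).
Proof.
by move=> [mg [M gM]]; split; [exact: measurableT_comp|exists M => w; exact: gM].
Qed.

Let ED g h : admissible g -> admissible h ->
  E (fun x => g x + h x) = E g + E h.
Proof.
by move=> /admX[mg bg] /admX[mh bh]; exact: bounded_RintegralD.
Qed.

Let EZ c g : admissible g -> E (fun x => c * g x) = c * E g.
Proof. by move=> /admX[mg bg]; exact: bounded_RintegralZl. Qed.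

Let Ecst c : E (fun=> c) = c.
Proof. exact: prob_Rintegral_cst. Qed.

Let ID g h pi : admissible g -> admissible h ->
  I (fun x => g x + h x) pi = I g pi + I h pi.
Proof. by move=> [mg bg] [mh bh]; exact: bounded_RintegralD. Qed.

Let IZ c g pi : admissible g -> I (fun x => c * g x) pi = c * I g pi.
Proof. by move=> [mg bg]; exact: bounded_RintegralZl. Qed.

Let Icst c pi : I (fun=> c) pi = c.
Proof. exact: prob_Rintegral_cst. Qed.

Let adm_cst c : admissible (fun=> c).
Proof. by split=> //; exact: fbounded_cst. Qed.

Let admD g h : admissible g -> admissible h ->
  admissible (fun x => g x + h x).
Proof.
by move=> [mg bg] [mh bh]; split; [exact: measurable_funD|exact: fboundedD].
Qed.

Let admZ c g : admissible g -> admissible (fun x => c * g x).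
Proof.
move=> [mg bg]; split; first exact: measurable_funM.
by apply: fboundedM => //; exact: fbounded_cst.
Qed.

Let Ibounded g : admissible g -> fbounded (I g).
Proof.
by move=> [mg [M gM]]; exists M => pi; exact: norm_Rintegral_le.
Qed.

(** Makes the symmetric norm bound one-sided. The values of [I g] lie between [- K = c - r] and
    [b = c + r], so [(g - c) / r] satisfies the constraint of the norm, and its expectation being at
    most 1 means [E g <= c + r = b]. *)
Let Tnorm_upper g b : admissible g -> (forall pi, I g pi <= b) -> E g <= b.
Proof.
move=> ag Ib; have [mg [M gM]] := ag.
pose K := `|M| + `|b| + 1; pose c := (b - K) / 2; pose r := (b + K) / 2.
have r0 : 0 < r.
  have : - `|b| <= b by rewrite lerNl -normrN ler_norm.
  by have := normr_ge0 M; rewrite /r /K; lra.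
have IK pi : - K <= I g pi.
  have : `|I g pi| <= M by exact: norm_Rintegral_le.
  rewrite ler_norml => /andP[+ _]; have := ler_norm M; have := normr_ge0 b.
  by rewrite /K; lra.
pose g' := fun x => r^-1 * (g x + - c).
have ag' : admissible g' by apply/admZ/admD.
have Ig' pi : I g' pi = r^-1 * (I g pi - c).
  by rewrite IZ ?ID ?Icst//; exact: admD.
have Eg' : E g' = r^-1 * (E g - c) by rewrite EZ ?ED ?Ecst//; exact: admD.
have : `|E g'| <= 1.
  apply: (Tnorm_eq1 P mX).1 T1 _ ag'.1 ag'.2 _ => pi.
  rewrite (IgE pi ag'.1 ag'.2) /= lee_fin -/(I g' pi) Ig'.
  rewrite ler_norml ler_pdivlMl// ler_pdivrMl//.
  by have := IK pi; have := Ib pi; rewrite /r /c; lra.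
rewrite ler_norml Eg' => /andP[_]; rewrite ler_pdivrMl// mulr1 /r /c.
lra.
Qed.

(** The sublinear majorant of [h] is the infimum of [E g] over all [g] with [h <= I g]; the norm
    hypothesis is exactly what keeps it finite. Any linear functional below it has the required
    values, by testing [g] and [- g], and is positive, because [- h <= I 0] for [h >= 0]. *)
Lemma Tnorm_functional : exists Lambda : (probability T R -> R) -> R,
  positive_functional (@fbounded R (probability T R)) Lambda /\
  forall g : prodn T n -> R, measurable_fun setT g -> fbounded g ->
    Lambda (fun pi => \int[powP pi n]_x g x) = \int[P]_w g (X w).
Proof.
(* [R^o] supplies the module structure on functions that [hahn_banach] expects. *)
pose V := (probability T R -> R^o).
pose F (h : V) := [set E g | g in
  [set g | admissible g /\ forall pi, h pi <= I g pi]].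
have F0 h : fbounded h -> F h !=set0.
  move=> [M hM]; exists (E (fun=> M)), (fun=> M) => //; split=> // pi.
  by rewrite Icst; apply: le_trans (ler_norm _) (hM pi).
have Flb h : fbounded h -> has_lbound (F h).
  move=> [M hM]; exists (- M) => _ [g [ag gI] <-].
  suff : E (fun x => -1 * g x) <= M by rewrite EZ//; lra.
  apply: Tnorm_upper => [|pi]; first exact: admZ.
  rewrite IZ//; have := hM pi; rewrite ler_norml => /andP[+ _].
  by have := gI pi; lra.
have Fle h g : fbounded h -> admissible g -> (forall pi, h pi <= I g pi) ->
    inf (F h) <= E g.
  by move=> bh ag hg; apply: ge_inf; [exact: Flb|exists g].
have [||| L [LD LZ Lp]] := @hahn_banach R V (@fbounded R _) _ _ (fun h => inf (F h)).
- by move=> h k bh bk; exact: fboundedD.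
- by move=> c h bh; apply: fboundedM => //; exact: fbounded_cst.
- split=> [h k bh bk|c h c0 bh].
    apply/ler_addgt0Pr => e e0; have e2 : 0 < e / 2 by lra.
    have [_ [g [ag gI] <-] gh] := inf_adherent e2 (conj (F0 _ bh) (Flb _ bh)).
    have [_ [g' [ag' gI'] <-] gk] := inf_adherent e2 (conj (F0 _ bk) (Flb _ bk)).
    have := Fle (h + k) (fun x => g x + g' x) (fboundedD bh bk) (admD ag ag').
    rewrite ED// => H; apply: le_trans (H _) _; last by lra.
    by move=> pi; rewrite ID//; exact: lerD.
  have bch : fbounded (c *: h : V).
    by apply: (fboundedM _ bh); exact: fbounded_cst.
  apply/ler_addgt0Pr => e e0.
  (* Dividing by [c + 1] rather than [c] covers the case [c = 0]. *)
  have e1 : 0 < e / (c + 1) by rewrite divr_gt0// ltr_wpDl.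
  have [_ [g [ag gI] <-] gh] := inf_adherent e1 (conj (F0 _ bh) (Flb _ bh)).
  have := Fle (c *: h : V) (fun x => c * g x) bch (admZ c ag).
  rewrite EZ// => H; apply: le_trans (H _) _.
    by move=> pi; rewrite IZ//; exact: ler_wpM2l.
  apply: (@le_trans _ _ (c * (inf (F h) + e / (c + 1)))).
    by apply: ler_wpM2l => //; exact: ltW.
  rewrite mulrDr lerD2l mulrA ler_pdivrMr ?ltr_wpDl// mulrC.
  by apply: ler_wpM2l; [exact: ltW|lra].
have LE g : admissible g -> L (I g) = E g.
  move=> ag; have bI := Ibounded ag.
  apply/eqP; rewrite eq_le; apply/andP; split.
    by apply: le_trans (Lp _ bI) _; exact: Fle.
  have := Lp (I (fun x => -1 * g x)) (Ibounded (admZ (-1) ag)).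
  have -> : I (fun x => -1 * g x) = (-1 *: (I g : V)).
    by apply/funext => pi; rewrite IZ.
  rewrite LZ// => H; have : -1 * L (I g) <= E (fun x => -1 * g x).
    apply: le_trans H _; apply: Fle; last by move=> pi; rewrite IZ.
      by apply: (fboundedM _ bI); exact: fbounded_cst.
    exact: admZ.
  by rewrite EZ//; lra.
exists L; split; last by move=> g mg bg; exact: LE.
split=> //.
- rewrite -[RHS](Ecst 1) -LE//; congr L; apply/funext => pi; exact/esym/Icst.
- move=> h bh h0; suff : L (-1 *: (h : V)) <= 0 by rewrite LZ//; lra.
  have bNh : fbounded (-1 *: (h : V)).
    by apply: (fboundedM _ bh); exact: fbounded_cst.
  apply: le_trans (Lp _ bNh) _; rewrite -[leRHS](Ecst 0); apply: Fle => // pi.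
  rewrite Icst; have := h0 pi.
  by rewrite -[X in _ -> X <= 0]/(-1 * h pi); lra.
Qed.

End Tnorm_functional.

(** * Vague continuity and sigma-continuity on the space of probabilities *)

Section vague_continuity.
Context {R : realType} {S : ptopologicalType}.
Let M := probability (baire R S) R.

Definition vague_cvg (G : set_system M) (pi : M) :=
  forall f : S -> R, cc1 f ->
    (fun rho : M => \int[rho]_x f x) @ G --> (\int[pi]_x f x : R).

(** Continuity is tested along ultrafilters, so no topology on probabilities has to be built; the
    limit taken in [tight_daniell] is along an ultrafilter. *)
Definition vague_continuous : set (M -> R) := [set h | fbounded h /\
  forall G : set_system M, UltraFilter G -> forall pi, vague_cvg G pi ->
    h @ G --> h pi].

Lemma function_algebra_vague : function_algebra vague_continuous.
Proof.
have BA := @function_algebra_fbounded R M.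
split.
- by move=> c; split=> [|G UG pi _]; [exact: fbounded_cst|exact: cvg_cst].
- move=> f g [bf cf] [bg cg]; split=> [|G UG pi Gpi]; first exact: fboundedD.
  by apply: cvgD; [exact: cf|exact: cg].
- move=> f g [bf cf] [bg cg]; split=> [|G UG pi Gpi]; first exact: fboundedM.
  by apply: cvgM; [exact: cf|exact: cg].
- move=> f [bf cf]; split=> [|G UG pi Gpi]; first exact: (fa_pos BA).
  under eq_fun do rewrite maxr_absE addr0 subr0.
  rewrite maxr_absE addr0 subr0; have fG := cf _ UG _ Gpi.
  by apply: cvgM; [apply: cvgD => //; exact: cvg_norm|exact: cvg_cst].
- by move=> f [].
Qed.

Lemma vague_continuous_integral (f : S -> R) : cc1 f ->
  vague_continuous (fun pi => \int[pi]_x f x).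
Proof.
move=> cf; split=> [|G UG pi]; last exact.
have [K fK] := fa_bounded function_algebra_cc1 cf.
by exists K => pi; apply: norm_Rintegral_le => //; exact: measurable_cc1.
Qed.

(** Supplies the measurability hypothesis of [daniell_stone]. The mass of a positivity set is the
    limit of integrals of ramps, which are vaguely continuous in [pi]; a pi-system argument reaches
    all Baire sets. *)
Lemma pprobability_vague :
  @measurable _ (pprobability (baire R S) R) `<=`
  <<s positivity_sets vague_continuous >>.
Proof.
pose U := g_sigma_algebraType (positivity_sets vague_continuous).
have mU (A : set (baire R S)) : measurable A ->
    measurable_fun (setT : set U) (fun mu : U => (mu : M) A).
  apply: (@measurable_prob_pi_system R _ U _ (baire R S) (fun mu => mu)
    (positivity_sets cc1)).
  - exact: measurable_baireE.
  - exact: positivity_setsI function_algebra_cc1.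
  move=> _ [f cf ->]; set B := [set x | 0 < f x].
  have mB : measurable (B : set (baire R S)).
    by rewrite measurable_baireE; apply: sub_sigma_algebra; exists f.
  have crf k : cc1 (ramp f k) by apply: fa_ramp => //; exact: function_algebra_cc1.
  apply: (@emeasurable_fun_cvg _ _ _ _
    (fun k (mu : U) => (\int[(mu : M)]_x ramp f k x)%:E)).
    move=> k; apply/measurable_EFinP.
    apply: (@positivity_measurable_fun R _ U vague_continuous).
    - exact: function_algebra_vague.
    - exact: sub_sigma_algebra.
    - exact: vague_continuous_integral.
  move=> mu _; rewrite -[X in _ --> X]fineK ?fin_num_measure//.
  rewrite -Rintegral_indic//; apply: cvg_EFin; first exact: nearW.
  apply: (bounded_cvg_Rintegral (M := 1)).
  - by move=> k; exact: measurable_cc1.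
  - exact: measurable_indic.
  - by move=> k x; rewrite ger0_norm ?ramp_ge0// ramp_le1.
  - by move=> x; exact: cvg_ramp.
apply: smallest_sub; first exact: (sigma_algebra_measurable U).
move=> _ [r _ [A mA <-]].
have /(_ measurableT _ (emeasurable_itv `]-oo, r%:E[)) := mU _ mA.
by rewrite setTI; congr measurable.
Qed.

(* Prokhorov's theorem in disguise: along an ultrafilter of probabilities
   that is uniformly tight, integrals converge to a positive functional that
   Riesz represents by a probability. *)
Lemma tight_daniell (mu1 : probability (baire R S) R) (L : (M -> R) -> R) :
  positive_functional (@fbounded R M) L ->
  (forall f, cc1 f -> L (fun pi => \int[pi]_x f x) = \int[mu1]_x f x) ->
  (forall e, 0 < e -> exists f : S -> R, [/\ cc_fun f, forall x, 0 <= f x <= 1 &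
    1 - e <= \int[mu1]_x f x]) ->
  daniell_continuous vague_continuous L.
Proof.
move=> PL L1 tmu h vh dh h0 hcvg e e0.
have BA := @function_algebra_fbounded R M.
have bh m : fbounded (h m) by case: (vh m).
have [K hK] := bh 0%N.
pose C := `|K| + 1; have C0 : 0 < C by rewrite ltr_pwDr.
have hm m k pi : (k <= m)%N -> h m pi <= h k pi.
  move=> /subnK <-; elim: (m - k)%N => // j IH.
  by rewrite addSn; apply: le_trans (dh _ _) IH.
have hC m pi : h m pi <= C.
  apply: le_trans (hm _ 0%N _ (leq0n _)) _; apply: le_trans (ler_norm _) _.
  by apply: le_trans (hK pi) _; rewrite /C (le_trans (ler_norm K))// lerDl.
(* Chosen so that [C * eta * 2 = e / 2], where 2 bounds the geometric sum of the [2^-1 ^+ m]. *)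
pose eta := e / (4 * C).
have eta0 : 0 < eta by rewrite divr_gt0// mulr_gt0.
have q0 m : 0 < (2^-1 : R) ^+ m by rewrite exprn_gt0// invr_gt0.
(* Of the two factors [2^-1 ^+ m], one pays for the Markov threshold [2^-1 ^+ m] and the other makes
   the errors summable. *)
have /choice[f fP] m : exists f : S -> R, [/\ cc_fun f, forall x, 0 <= f x <= 1 &
    1 - eta * (2^-1 ^+ m * 2^-1 ^+ m) <= \int[mu1]_x f x].
  by apply/tmu/(mulr_gt0 eta0)/mulr_gt0.
have cf m : cc1 (f m) by case: (fP m) => /cc_cc1.
pose If m (pi : M) := \int[pi]_x f m x.
have bIf m : fbounded (If m) by have [] := vague_continuous_integral (cf m).
have If1 m pi : If m pi <= 1.
  rewrite -[leRHS](prob_Rintegral_cst pi); apply: bounded_le_Rintegral.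
  - exact: measurable_cc1.
  - exact: fa_bounded function_algebra_cc1 _ _.
  - exact: measurable_cst.
  - exact: fbounded_cst.
  - by move=> x; have [_ /(_ x)/andP[]] := fP m.
apply: contrapT => /forallNP Lh.
(* Probabilities on which [h j] is still large and which satisfy the first [j] tightness conditions.
   An empty [A j] would give [L (h j) <= e], against the assumed failure. *)
pose A j := [set pi | e / 2 <= h j pi /\
  forall m, (m < j)%N -> 1 - If m pi <= 2^-1 ^+ m].
have A0 j : A j !=set0.
  apply: contrapT => /set0P/negP; rewrite negbK => /eqP Aj0; apply: (Lh j).
  (* Markov's inequality in functional form: [w m] is at least [C], hence at least [h j], wherever
     condition [m] fails. *)
  pose w m pi := C * 2 ^+ m * (1 - If m pi).
  have bw m : fbounded (w m).
    apply: (fa_scale BA); apply: (fa_sub BA) => //; exact: fbounded_cst.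
  have w0 m pi : 0 <= w m pi.
    by rewrite mulr_ge0 ?subr_ge0 ?If1// mulr_ge0// ltW.
  have hw pi : h j pi <= e / 2 + \sum_(m < j) w m pi.
    have s0 : 0 <= \sum_(m < j) w m pi by apply: sumr_ge0 => m _; exact: w0.
    have [hj|hj] := leP (e / 2) (h j pi); last by lra.
    have : ~ A j pi by rewrite Aj0.
    move=> /not_andP[//|/existsNP[m /not_implyP[mj /negP]]]; rewrite -ltNge => Hm.
    rewrite (bigD1 (Ordinal mj))//= in s0 *.
    have : C <= w m pi.
      rewrite /w -mulrA ler_pMr// -[leLHS](mulfV (x := 2 ^+ m)) ?expf_neq0//.
      by rewrite ler_pM2l ?exprn_gt0// -exprVn ltW.
    have : 0 <= \sum_(i < j | i != Ordinal mj) w i pi.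
      by apply: sumr_ge0 => i _; exact: w0.
    by have := hC j pi; lra.
  apply: (@le_trans _ _ (L (fun pi => e / 2 + \sum_(m < j) w m pi))).
    apply: (pf_le BA PL) => //; apply: fboundedD; first exact: fbounded_cst.
    exact: (fa_sum BA).
  rewrite (pf_add PL); [|exact: fbounded_cst|exact: (fa_sum BA)].
  rewrite (pf_cst BA PL) (pf_sum BA PL (f_ := w))//.
  have Lw m : L (w m) <= C * eta * 2^-1 ^+ m.
    rewrite (pf_scale PL); last first.
      by apply: (fa_sub BA) => //; exact: fbounded_cst.
    rewrite (pf_sub BA PL)//; last exact: fbounded_cst.
    rewrite (pf_one PL) L1//; have [_ _ Hm] := fP m.
    apply: (@le_trans _ _ (C * 2 ^+ m * (eta * (2^-1 ^+ m * 2^-1 ^+ m)))).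
      apply: ler_wpM2l; first by rewrite mulr_ge0// ltW.
      by lra.
    rewrite le_eqVlt; apply/orP; left; apply/eqP.
    have : (2 : R) ^+ m * 2^-1 ^+ m = 1 by rewrite -exprMn mulfV ?expr1n.
    move: (2 ^+ m) (2^-1 ^+ m) => a b ab1.
    by transitivity (C * eta * b * (a * b)); [ring|rewrite ab1 mulr1].
  have geo k : \sum_(m < k) (2^-1 : R) ^+ m = 2 - 2 * 2^-1 ^+ k.
    elim: k => [|k IH]; first by rewrite big_ord0 expr0; lra.
    by rewrite big_ord_recr/= IH exprS; lra.
  have : \sum_(m < j) L (w m) <= C * eta * 2.
    apply: (@le_trans _ _ (\sum_(m < j) C * eta * 2^-1 ^+ m)).
      by apply: ler_sum => m _; exact: Lw.
    rewrite -mulr_sumr geo; apply: ler_wpM2l; first by rewrite mulr_ge0 ?ltW.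
    by have := q0 j; lra.
  have -> : C * eta * 2 = e / 2 by rewrite /eta; field; rewrite gt_eqF.
  by lra.
have AS j k : (j <= k)%N -> A k `<=` A j.
  move=> jk pi [hk Hk]; split=> [|m mj]; last by apply: Hk; exact: leq_trans jk.
  exact: le_trans hk (hm _ _ _ jk).
have PF : ProperFilter (filter_from [set: nat] A).
  apply: filter_from_proper; last by move=> j _; exact: A0.
  apply: filter_fromT_filter; first by exists 0%N.
  move=> i j; exists (maxn i j) => pi Api.
  by split; apply: AS Api; rewrite leq_max leqnn ?orbT.
(* The ultrafilter contains every [A j], so along it all tightness conditions hold eventually and
   each [h j] stays at least [e / 2]. *)
have [G [UG FG]] := ultraFilterLemma PF.
have GA j : G (A j) by apply: FG; exists j.
have PG : ProperFilter G by exact: ultra_proper.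
pose phi (g : S -> R) (pi : M) := \int[pi]_x g x.
pose Phi g : R := lim (phi g @ G).
have cvgPhi g : cc1 g -> phi g @ G --> Phi g.
  move=> cg; have [bphi _] := vague_continuous_integral cg.
  by have [l Gl] := ultra_bounded_cvg UG bphi; rewrite /Phi (cvg_lim _ Gl).
have LA := @function_algebra_cc1 R S.
have Phi_eq g (l : R) : phi g @ G --> l -> Phi g = l by move=> /cvg_lim; exact.
have int_cc1 (g : S -> R) : cc1 g ->
    measurable_fun (setT : set (baire R S)) g /\ fbounded g.
  by move=> cg; split; [exact: (measurable_cc1 cg)|exact: (fa_bounded LA cg)].
have PPhi : positive_functional cc1 Phi.
  split.
  - move=> g k cg ck; apply: Phi_eq.
    rewrite (_ : phi _ = fun pi => phi g pi + phi k pi).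
      by apply: cvgD; exact: cvgPhi.
    have [mg bg] := int_cc1 _ cg; have [mk bk] := int_cc1 _ ck.
    by apply/funext => pi; exact: bounded_RintegralD.
  - move=> c g cg; apply: Phi_eq.
    rewrite (_ : phi _ = fun pi => c * phi g pi).
      by apply: cvgM; [exact: cvg_cst|exact: cvgPhi].
    have [mg bg] := int_cc1 _ cg.
    by apply/funext => pi; exact: bounded_RintegralZl.
  - apply: Phi_eq; rewrite (_ : phi _ = fun=> 1); first exact: cvg_cst.
    by apply/funext => pi; exact: prob_Rintegral_cst.
  - move=> g cg g0; apply: (cvgr_to_ge (cvgPhi _ cg)).
    by apply: nearW => pi; exact: Rintegral_ge0.
have [e' e'0|pi piPhi] := riesz_baire PPhi.
  have [m me] : exists m, (2^-1 : R) ^+ m <= e'.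
    have /cvgrPdist_le/(_ _ e'0)[m _ Hm] :
        (fun k => (2^-1 : R) ^+ k) @ \oo --> (0 : R).
      by apply: cvg_expr; rewrite ger0_norm; lra.
    exists m; have := Hm m (leqnn m).
    by rewrite /= sub0r normrN gtr0_norm.
  have [ccf f01 _] := fP m; exists (f m); split=> //.
  apply: (cvgr_to_ge (cvgPhi _ (cf m))).
  (* [A j] imposes only the conditions of index below [j], hence [m.+1]. *)
  apply: filterS (GA m.+1) => rho [_ /(_ m (ltnSn m))].
  by rewrite -[X in 1 - X <= _ -> _]/(phi (f m) rho); lra.
have Gpi : vague_cvg G pi by move=> g cg; rewrite piPhi//; exact: cvgPhi.
have e2 : 0 < e / 2 by rewrite divr_gt0.
have [m hmpi] := hcvg pi _ e2.
have [_ /(_ G UG pi Gpi) cvgh] := vh m.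
have : e / 2 <= h m pi.
  by apply: (cvgr_to_ge cvgh); apply: filterS (GA m) => rho [].
by lra.
Qed.

End vague_continuity.

(** * The mixing probability *)

Section Tnorm_mixture.
Context {R : realType} {S : ptopologicalType}.
Hypothesis S_hausdorff : hausdorff_space S.
Hypothesis S_lc : locally_compact [set: S].
Context (n : nat) (hn : (0 < n)%N) dO (Omega : measurableType dO).
Variables (P : probability Omega R) (X : Omega -> prodn (baire R S) n).
Hypothesis mX : measurable_fun setT X.
Hypothesis X1_tight :
  tight (fun A : set (baire R S) => P ((fun w => X w (Ordinal hn)) @^-1` A)).

Let measurable_int (f : S -> R) : cc1 f -> (forall x, 0 <= f x) ->
  measurable_fun setT (fun pi : pprobability (baire R S) R =>
    \int[(pi : probability (baire R S) R)]_x f x).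
Proof.
move=> cf f0; apply: measurableT_comp; first exact: fine_measurable.
apply: (@measurable_fun_integral_kernel _ _ (pprobability (baire R S) R)
  (baire R S) R (fun pi => (pi : probability (baire R S) R))
  _ (fun x => (f x)%:E)).
- by move=> U mU; exact: measurable_evalp.
- by move=> x; rewrite lee_fin.
- by apply/measurable_EFinP; exact: measurable_cc1.
Qed.

Lemma Tnorm_mixture : Tnorm P X = 1%E ->
  exists nu : probability (pprobability (baire R S) R) R,
    forall A : set (prodn (baire R S) n), measurable A ->
      P (X @^-1` A) = (\int[nu]_pi pown pi A)%E.
Proof.
move=> T1; have LA := @function_algebra_cc1 R S.
have int_cc1 (f : S -> R) : cc1 f ->
    measurable_fun (setT : set (baire R S)) f /\ fbounded f.
  by move=> cf; split; [exact: (measurable_cc1 cf)|exact: (fa_bounded LA cf)].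
have [L [PL LE]] := Tnorm_functional mX T1.
pose i0 := Ordinal hn.
have mX0 : measurable_fun setT (fun w => X w i0 : baire R S).
  exact: measurableT_comp (measurable_coord i0) mX.
pose mu1 : probability (baire R S) R := image_prob P mX0.
(* The barycentre of [L] is the law of [X_1]: [f] at coordinate [i0] is a tensor with all other
   factors 1. Tightness of that law thereby passes to [L]. *)
have L1 f : cc1 f -> L (fun pi => \int[pi]_x f x) = \int[mu1]_x f x.
  move=> cf; have [mf bf] := int_cc1 f cf; have [K fK] := bf.
  rewrite (Rintegral_image_prob P mX0)//.
  rewrite -(LE (fun x => f (x i0))); last 2 first.
  - exact: measurableT_comp mf (measurable_coord i0).
  - by exists K => x; exact: fK.
  congr L; apply/funext => pi.
  pose F (i : 'I_n) : S -> R := if i == i0 then f else fun=> 1.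
  have FE (x : 'I_n -> S) : \prod_i F i (x i) = f (x i0).
    rewrite (bigD1 i0)//= /F eqxx big1 ?mulr1// => i /negbTE -> //.
  have mF i : measurable_fun (setT : set (baire R S)) (F i).
    by rewrite /F; case: ifP.
  have bF i : fbounded (F i).
    by rewrite /F; case: ifP => // _; exact: fbounded_cst.
  have := powP_tensor pi mF bF.
  under eq_Rintegral do rewrite FE.
  move=> ->; rewrite (bigD1 i0)//= big1 ?mulr1.
    by rewrite /F eqxx.
  by move=> i /negbTE ii0; rewrite /F ii0 prob_Rintegral_cst.
have LV : positive_functional vague_continuous L.
  by apply: positive_functional_sub PL => f [].
have DL : daniell_continuous vague_continuous L.
  apply: (tight_daniell PL L1) => e e0.
  exact: (tight_cc_fun S_hausdorff S_lc (mu := mu1) X1_tight e0).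
have [nu nuE] := @daniell_stone R _ (pprobability (baire R S) R)
  vague_continuous L function_algebra_vague LV DL (@pprobability_vague R S).
exists nu => A mA; rewrite -(mixturePE nu mA).
rewrite -[LHS](image_probE P mX).
move: A mA; apply: (@prodn_prob_unique _ (baire R S) R n (positivity_sets cc1)
  (image_prob P mX) (mixtureP nu n)).
- exact: measurable_baireE.
- exact: positivity_setsI LA.
- exact: positivity_setsT LA.
move=> _ [B [GB ->]].
have mB i : measurable (B i : set (baire R S)).
  by rewrite measurable_baireE; exact: sub_sigma_algebra.
have /choice[f fP] i : exists f : S -> R, cc1 f /\ B i = [set x | 0 < f x].
  by have [f cf ->] := GB i; exists f.
have mRect := measurable_rect mB.
have cr i k : cc1 (ramp (f i) k) by apply: fa_ramp => //; exact: (fP i).1.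
have mr i k : measurable_fun (setT : set (baire R S)) (ramp (f i) k).
  exact: (int_cc1 _ (cr i k)).1.
have br i k : fbounded (ramp (f i) k) by exact: (int_cc1 _ (cr i k)).2.
have prod01 (u : 'I_n -> R) : (forall i, 0 <= u i <= 1) -> `|\prod_i u i| <= 1.
  move=> u01; rewrite ger0_norm; last by apply: prodr_ge0 => i _; case/andP: (u01 i).
  apply: le_trans (_ : \prod_(i < n) (1 : R) <= 1); last by rewrite big1_eq.
  by apply: ler_prod => i _; exact: u01.
have int01 (pi : probability (baire R S) R) (g : S -> R) :
    measurable_fun (setT : set (baire R S)) g -> (forall x, 0 <= g x <= 1) ->
    0 <= \int[pi]_x g x <= 1.
  move=> mg g01; rewrite Rintegral_ge0; last by move=> x _; case/andP: (g01 x).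
  rewrite -[leRHS](prob_Rintegral_cst pi); apply: bounded_le_Rintegral => //.
  - exists 1 => x; have /andP[g0 g1] := g01 x.
    by rewrite ger0_norm.
  - exact: fbounded_cst.
  - by move=> x; case/andP: (g01 x).
have ramp01 i k x : 0 <= ramp (f i) k x <= 1 by rewrite ramp_ge0 ramp_le1.
(* [nu] reproduces [L] only on vaguely continuous functions, so the indicator of a rectangle is
   approached by tensors of ramps, whose power integrals are products of vaguely continuous
   functions. Both sides agree for each [k] and pass to the limit by dominated convergence. *)
pose F k (x : prodn (baire R S) n) := \prod_i ramp (f i) k (x i).
have mF k : measurable_fun setT (F k).
  exact: (@measurable_tensor _ (baire R S) R n (fun i => ramp (f i) k) (mr^~ k)).
have F1 k x : `|F k x| <= 1 by apply: prod01 => i; exact: ramp01.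
have cvgF : (fun k => \int[image_prob P mX]_x F k x) @ \oo -->
    fine (image_prob P mX [set x | forall i, B i (x i)]).
  rewrite -Rintegral_indic//; apply: (bounded_cvg_Rintegral (M := 1)) => //.
  move=> x; rewrite indic_rect; apply: cvg_prodr => i.
  by rewrite (fP i).2; exact: cvg_ramp.
pose H k (pi : pprobability (baire R S) R) :=
  \prod_i \int[(pi : probability (baire R S) R)]_x ramp (f i) k x.
have mH k : measurable_fun setT (H k).
  apply: measurable_prod => i _; apply: measurable_int => // x.
  exact: ramp_ge0.
have FH k : \int[image_prob P mX]_x F k x = \int[nu]_pi H k pi.
  rewrite Rintegral_image_prob//; last by exists 1; exact: F1.
  rewrite -(LE (F k))//; last by exists 1; exact: F1.
  rewrite nuE//.
    congr L; apply/funext => pi.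
    exact: (powP_tensor pi (mr^~ k) (br^~ k)).
  apply: fa_prod; first exact: function_algebra_vague.
  by move=> i; exact: vague_continuous_integral.
have cvgH : (fun k => \int[nu]_pi H k pi) @ \oo -->
    fine (mixtureP nu n [set x | forall i, B i (x i)]).
  have -> : fine (mixtureP nu n [set x | forall i, B i (x i)]) =
      \int[nu]_pi \prod_i fine ((pi : probability (baire R S) R) (B i)).
    by congr fine; apply: eq_integral => pi _; exact: powP_rect.
  apply: (bounded_cvg_Rintegral (M := 1)) => //.
  - apply: measurable_prod => i _; apply: measurableT_comp; first exact: fine_measurable.
    exact: measurable_evalp.
  - by move=> k pi; apply: prod01 => i; apply: int01.
  - move=> pi; apply: cvg_prodr => i; rewrite -Rintegral_indic//.
    apply: (bounded_cvg_Rintegral (M := 1)) => //.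
    + by move=> k x; rewrite ger0_norm ?ramp_ge0// ramp_le1.
    + by move=> x; rewrite (fP i).2; exact: cvg_ramp.
rewrite -[LHS]fineK ?fin_num_measure// -[RHS]fineK ?fin_num_measure//.
move: cvgF; rewrite (funext FH) => cvgF; congr EFin.
exact: cvg_unique cvgF cvgH.
Qed.

End Tnorm_mixture.

Theorem theorem4 (R : realType) (S : ptopologicalType)
    (S_hausdorff : hausdorff_space S) (S_lc : locally_compact [set: S])
    (n : nat) (hn : (0 < n)%N)
    (dO : measure_display) (Omega : measurableType dO)
    (P : probability Omega R) (X : Omega -> prodn (baire R S) n)
    (mX : measurable_fun setT X)
    (X_exch : exchangeable P X)
    (X1_outer : outer_regular
       (fun A : set (baire R S) => P ((fun w => X w (Ordinal hn)) @^-1` A)))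
    (X1_tight : tight
       (fun A : set (baire R S) => P ((fun w => X w (Ordinal hn)) @^-1` A))) :
  [/\ ((forall (N : nat) (nN : (n <= N)%N), extendible P X nN) <->
       Tnorm P X = 1%E),
      (Tnorm P X = 1%E <->
       exists nu : probability (pprobability (baire R S) R) R,
         forall A : set (prodn (baire R S) n), measurable A ->
           P (X @^-1` A) = (\int[nu]_pi pown pi A)%E) &
      ((exists nu : probability (pprobability (baire R S) R) R,
         forall A : set (prodn (baire R S) n), measurable A ->
           P (X @^-1` A) = (\int[nu]_pi pown pi A)%E) <->
       (forall (N : nat) (nN : (n <= N)%N), extendible P X nN))].
Proof.
have ext_T : (forall N (nN : (n <= N)%N), extendible P X nN) -> Tnorm P X = 1%E.
  exact: extendible_Tnorm mX.
have T_mix := Tnorm_mixture S_hausdorff S_lc mX X1_tight.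
have mix_ext : (exists nu : probability (pprobability (baire R S) R) R,
    forall A : set (prodn (baire R S) n), measurable A ->
      P (X @^-1` A) = (\int[nu]_pi pown pi A)%E) ->
    forall N (nN : (n <= N)%N), extendible P X nN.
  by move=> [nu Pnu]; exact: mixture_extendible Pnu.
by split; split=> // ?; [exact/mix_ext/T_mix|exact/ext_T/mix_ext|exact/T_mix/ext_T].
Qed.
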